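(* Let $A(D)$ be a homogeneous linear differential operator of order $k \ge n$ on $\mathbf{R}^n$ from $V$ to $E$. If $A(D)$ is elliptic and canceling, then there exists $C>0$ such that for every $u \in C^\infty_c(\mathbf{R}^n; V)$, $$\sup_{x \in \mathbf{R}^n} |D^{k-n}u(x)| \le C \int_{\mathbf{R}^n} |A(D)u|.$$
   Context: Here $V$, $E$ are real finite-dimensional vector spaces (endowed with fixed inner products). A homogeneous linear differential operator $A(D)$ of order $k$ on $\mathbf{R}^n$ from $V$ to $E$ is an operator with constant coefficients $A(D)u = \sum_{\alpha \in \mathbf{N}^n, |\alpha|=k} A_\alpha[\partial^\alpha u] \in C^\infty(\mathbf{R}^n;E)$ for $u \in C^\infty(\mathbf{R}^n;V)$, where each $A_\alpha \in \mathcal{L}(V;E)$ is a linear map. For $\xi \in \mathbf{R}^n$, $A(\xi) = \sum_{|\alpha|=k} \xi^\alpha A_\alpha \in \mathcal{L}(V;E)$. The operator $A(D)$ is elliptic if $A(\xi)$ is one-to-one for every $\xi \in \mathbf{R}^n\setminus\{0\}$. It is canceling if $\bigcap_{\xi \in \mathbf{R}^n\setminus\{0\}} A(\xi)[V] = \{0\}$. $D^j u$ denotes the (total) derivative of order $j$ of $u$, with $D^0u=u$. *)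

(* Defs.v *)
From HB Require Import structures.
From mathcomp Require Import all_boot all_order all_algebra.
From mathcomp Require Import sesquilinear.
From mathcomp Require Import all_classical all_reals all_analysis.

Set Implicit Arguments.
Unset Strict Implicit.
Unset Printing Implicit Defensive.

Import Order.TTheory GRing.Theory Num.Theory.
Import numFieldNormedType.Exports.

Local Open Scope classical_set_scope.
Local Open Scope ring_scope.

#[short(type="normedVectType")]
HB.structure Definition NormedVector (R : numFieldType) :=
  {V of Vector R V & NormedModule R V}.

(* The norm (hence the topology) of V is the one of the inner product dot. *)
Definition norm_of_dot (R : realType) (V : normedVectType R)
    (dot : {dot V for (@idfun R)}) : Prop :=
  forall v : V, `|v| = Num.sqrt (dot v v).

(* Lebesgue measure on R^n, carried by n-tuples with the product sigma-algebra:
   the n-fold product of the one-dimensional Lebesgue measure. *)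
Section lebesgue_measure_tuple.
Context {R : realType}.
Local Notation RT := (measurableTypeR R).

Definition tuple_cons n (p : RT * n.-tuple RT) : n.+1.-tuple RT :=
  [tuple of p.1 :: p.2].

Lemma measurable_tuple_cons n :
  measurable_fun [set: RT * n.-tuple RT] (@tuple_cons n).
Proof. exact: measurable_cons. Qed.

Let tuple_uncons n (t : n.+1.-tuple RT) : RT * n.-tuple RT :=
  (tnth t ord0, [tuple of behead t]).

Let tuple_consK n : cancel (@tuple_cons n) (@tuple_uncons n).
Proof. by move=> [x t]; congr pair; apply/val_inj. Qed.

Let measurable_tuple_uncons n :
  measurable_fun [set: n.+1.-tuple RT] (@tuple_uncons n).
Proof.
apply: measurable_fun_pair; [exact: measurable_tnth|exact: measurable_behead].
Qed.

Section succ.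
Variables (n : nat) (mu : {sigma_finite_measure set (n.-tuple RT) -> \bar R}).

Definition cons_measure : set (n.+1.-tuple RT) -> \bar R :=
  pushforward (@lebesgue_measure R \x mu)%E (@tuple_cons n).

Let cons_measure0 : cons_measure set0 = 0%E.
Proof. by rewrite /cons_measure /pushforward preimage_set0 measure0. Qed.

Let cons_measure_ge0 A : (0 <= cons_measure A)%E.
Proof. exact: (measure_ge0 (@lebesgue_measure R \x mu)%E). Qed.

Let cons_measure_sigma_additive : semi_sigma_additive cons_measure.
Proof.
move=> F mF tF mUF; rewrite /cons_measure /pushforward preimage_bigcup.
have mcons A : measurable A -> measurable (@tuple_cons n @^-1` A).
  by move=> mA; rewrite -[X in measurable X]setTI; exact: measurable_tuple_cons.
apply: measure_semi_sigma_additive.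
- by move=> i; exact: mcons.
- apply/trivIsetP => /= i j _ _ ij; rewrite -preimage_setI.
  by move/trivIsetP : tF => /(_ _ _ _ _ ij) ->//; rewrite preimage_set0.
- by rewrite -preimage_bigcup; exact: mcons.
Qed.

HB.instance Definition _ := isMeasure.Build _ _ _ cons_measure
  cons_measure0 cons_measure_ge0 cons_measure_sigma_additive.

Let cons_measure_sigma_finite : sigma_finite setT cons_measure.
Proof.
have /sigma_finiteP[F [TF ndF Foo]] := sigma_finiteT (@lebesgue_measure R).
have /sigma_finiteP[G [TG ndG Goo]] := sigma_finiteT mu.
exists (fun i => @tuple_uncons n @^-1` (F i `*` G i)).
  rewrite -preimage_bigcup -[LHS](preimage_setT (@tuple_uncons n)).
  congr (_ @^-1` _); rewrite -setXTT TF TG predeqE => -[x y]; split.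
    move=> [/= [i _ Fix] [j _ Gjy]]; exists (maxn i j) => //; split.
    - by move: x Fix; exact/subsetPset/ndF/leq_maxl.
    - by move: y Gjy; exact/subsetPset/ndG/leq_maxr.
  by move=> [i _ []/= ? ?]; split; exists i.
move=> i; have [mF Foo'] := Foo i; have [mG Goo'] := Goo i; split.
  rewrite -[X in measurable X]setTI; apply: measurable_tuple_uncons => //.
  exact: measurableX.
rewrite /cons_measure /pushforward -comp_preimage.
rewrite (_ : @tuple_uncons n \o @tuple_cons n = id); last first.
  by apply/funext => p; exact: tuple_consK.
rewrite preimage_id.
by rewrite product_measure1E// lte_mul_pinfty// ge0_fin_numE.
Qed.

HB.instance Definition _ := Measure_isSigmaFinite.Build _ _ _ cons_measure
  cons_measure_sigma_finite.

End succ.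

Fixpoint lebesgue_measure_tuple (n : nat) :
    {sigma_finite_measure set (n.-tuple RT) -> \bar R} :=
  match n return {sigma_finite_measure set (n.-tuple RT) -> \bar R} with
  | 0 => \d_ ([tuple] : 0.-tuple RT)
  | n'.+1 => cons_measure (lebesgue_measure_tuple n')
  end.

End lebesgue_measure_tuple.

Section differential_operator.
Context {R : realType}.

(* {alpha in N^n : |alpha| = k}; the bound alpha_i <= k is implied. *)
Definition multi_index (n k : nat) : Type :=
  {a : {ffun 'I_n -> 'I_k.+1} | (\sum_i a i == k)%N}.

(* The coefficients A_alpha, |alpha| = k, of a homogeneous operator A(D) of
   order k on R^n from V to E. *)
Definition homogeneous_operator (n k : nat) (V E : vectType R) : Type :=
  multi_index n k -> 'Hom(V, E).

Definition basis_vector n (i : 'I_n) : 'rV[R]_n := delta_mx 0 i.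

Section derivatives.
Variables (n : nat) (W : normedModType R).
Implicit Types (u : 'rV[R]_n -> W).

Definition iter_derive (vs : seq 'rV[R]_n) u : 'rV[R]_n -> W :=
  foldr (fun v f => 'D_v f) u vs.

Definition partials (s : seq 'I_n) u : 'rV[R]_n -> W :=
  iter_derive (map (@basis_vector n) s) u.

Definition multi_partial k (a : multi_index n k) u : 'rV[R]_n -> W :=
  partials (flatten [seq nseq (val a i) i | i <- enum 'I_n]) u.

Definition smooth u : Prop :=
  forall s : seq 'I_n, continuous (partials s u) /\
    forall x i, derivable (partials s u) x (basis_vector i).

Definition compactly_supported u : Prop :=
  compact (closure [set x | u x != 0]).

(* D^j u(x) as a map of j vectors. *)
Definition total_derivative j u (x : 'rV[R]_n) : j.-tuple 'rV[R]_n -> W :=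
  fun vs => iter_derive vs u x.

(* Euclidean (Hilbert-Schmidt) norm of a j-linear map on R^n. *)
Definition multilinear_norm j (T : j.-tuple 'rV[R]_n -> W) : R :=
  Num.sqrt (\sum_(i : j.-tuple 'I_n) `|T (map_tuple (@basis_vector n) i)| ^+ 2).

End derivatives.

Section symbol.
Variables (n k : nat) (V E : normedVectType R) (A : homogeneous_operator n k V E).

Definition symbol (xi : 'rV[R]_n) : 'Hom(V, E) :=
  \sum_(a : multi_index n k) (\prod_i xi 0 i ^+ val a i) *: A a.

Definition apply_operator (u : 'rV[R]_n -> V) (x : 'rV[R]_n) : E :=
  \sum_(a : multi_index n k) A a (multi_partial a u x).

Definition elliptic : Prop :=
  forall xi : 'rV[R]_n, xi != 0 -> injective (symbol xi).

Definition canceling : Prop :=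
  \bigcap_(xi in [set xi : 'rV[R]_n | xi != 0]) range (symbol xi) = [set 0].

End symbol.

(* Row vectors carry the norm and the derivatives, tuples the measure. *)
Definition integral_Rn n (f : 'rV[R]_n -> \bar R) : \bar R :=
  (\int[lebesgue_measure_tuple n]_t f (\row_i tnth t i))%E.

End differential_operator.

(* Main.v *)
(* Let A(xi) act on row vectors, b = det(A A^T)^2 and let Q be the polynomial
   matrix with A Q = b I. The kernels eta_l(z) = l^n eta(l z), where eta has
   Fourier transform (1 + b)^(-N), form an approximate identity up to the
   factor int eta > 0. Let w be a component of D^(k-n) u. Then int w eta_l(. - x)
   tends to (int eta) w(x) as l -> oo and to 0 as l -> 0. As the Fourier transform
   of eta_l - eta_(l/2) is divisible by b, the difference between two dyadic scales
   is int A(D)u . K(l(. - x)), where K is a bounded kernel with fast decay; there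
   is no factor l because w has exactly k - n derivatives.
   Ellipticity alone only bounds each difference by C int |A(D)u|. For
   cancellation, A (b I - Q A) = 0, so each column c of b I - Q A is a homogeneous
   field of covectors annihilated by A, and its values at frequencies v <> 0 span
   the whole space when A is canceling. Moving derivatives in frequency from c to
   the kernel shows that K may be replaced by kernels bounded by s / (1 + s)^2 with
   s = l |y - x|; since this is at most 2 (B(s) - B(s / 2)) with
   B(s) = s / (1 + s) <= 1, the sum over dyadic scales telescopes. *)
Require Import Defs.
From mathcomp Require Import all_boot all_order all_algebra.
From mathcomp Require Import sesquilinear.
From mathcomp Require Import all_classical all_reals all_analysis.
From mathcomp Require Import measurable_realfun.
From mathcomp Require Import ring lra zify.

Set Implicit Arguments.
Unset Strict Implicit.
Unset Printing Implicit Defensive.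

Import Order.TTheory GRing.Theory Num.Theory.
Import numFieldNormedType.Exports.

Local Open Scope classical_set_scope.
Local Open Scope ring_scope.

(** The inverse symbol Q / b is homogeneous of degree -k, hence singular at frequency 0. Powers of 1
    / (1 + b) avoid this: the frequency kernels built from A are polynomials times such powers, they
    lie in classes closed under products and derivatives, and all integrals converge absolutely.
    Decay in space is bought by differentiating in frequency, decay in frequency by raising N. The
    exponent N = 2n + (k + 1) + deg b adds up three costs: 2n for integrability, k + 1 for moving
    the derivatives of A(D) onto a kernel that stays continuous, deg b to absorb the growth of the
    covectors c. The divergence to be cured is at coarse scales: as l -> 0 the kernel K(l(y - x))
    tends to K(0), so infinitely many scales contribute equally unless the kernel vanishes at 0. At
    fine scales the decay of K is enough. The bound s / (1 + s)^2 expresses both effects. *)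

Lemma continuous_compose {T U V : topologicalType} (f : T -> U) (g : U -> V) :
  continuous f -> continuous g -> continuous (fun x => g (f x)).
Proof. by move=> cf cg x; exact: (cvg_comp _ _ (cf x) (cg (f x))). Qed.

Lemma lipschitz_continuous {R : realType} (V W : normedModType R) (f : V -> W) (L : R) :
  0 <= L -> (forall x y, `|f x - f y| <= L * `|x - y|) -> continuous f.
Proof.
move=> L0 lip x.
(* [L] may be 0, so the tolerance is divided by [L + 1]. *)
have L1 : 0 < L + 1 by rewrite ltr_wpDl.
apply/(@cvgrPdist_le _ _ _ (nbhs x) (nbhs_filter x)) => e e0; near=> y.
rewrite (le_trans (lip _ _))//.
apply: (@le_trans _ _ ((L + 1) * `|x - y|)); first by rewrite ler_wpM2r// lerDl.
rewrite -ler_pdivlMl// mulrC; near: y.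
apply: (@cvgr_dist_le _ _ _ (nbhs x) (nbhs_filter x) id x); first exact: cvg_id.
by rewrite divr_gt0.
Unshelve. all: by end_near. Qed.

Section continuous_pointwise.
Context {R : realType} {T : topologicalType}.
Implicit Types f g : T -> R.

Lemma continuous_mul f g :
  continuous f -> continuous g -> continuous (fun x => f x * g x).
Proof. by move=> cf cg x; exact: (@cvgM _ _ (nbhs x) _ f g _ _ (cf x) (cg x)). Qed.

Lemma continuous_add (V : normedModType R) (f g : T -> V) :
  continuous f -> continuous g -> continuous (fun x => f x + g x).
Proof. by move=> cf cg x; exact: (@cvgD _ _ _ (nbhs x) _ f g _ _ (cf x) (cg x)). Qed.

Lemma continuous_oppr f : continuous f -> continuous (fun x => - f x).
Proof. by move=> cf x; exact: (@cvgN _ _ _ (nbhs x) _ f _ (cf x)). Qed.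

Lemma continuous_inv f : continuous f -> (forall x, f x != 0) ->
  continuous (fun x => (f x)^-1).
Proof. by move=> cf f0 x; exact: (@cvgV _ _ (nbhs x) _ f _ (f0 x) (cf x)). Qed.

Lemma continuous_abs (V : normedModType R) (f : T -> V) :
  continuous f -> continuous (fun x => `|f x|).
Proof. by move=> cf x; exact: (@cvg_norm _ _ _ (nbhs x) _ f _ (cf x)). Qed.

Lemma continuous_exprn f m : continuous f -> continuous (fun x => f x ^+ m).
Proof.
move=> cf; elim: m => [|m IH].
  rewrite (_ : (fun _ => _) = cst 1); first exact: cst_continuous.
  by apply/funext => y; rewrite expr0.
rewrite (_ : (fun _ => _) = fun y => f y * f y ^+ m); first exact: continuous_mul.
by apply/funext => y; rewrite exprS.
Qed.

Lemma continuous_sum (V : normedModType R) I (s : seq I) (P : pred I)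
    (f : I -> T -> V) :
  (forall i, continuous (f i)) -> continuous (fun x => \sum_(i <- s | P i) f i x).
Proof.
move=> cf; elim: s => [|a s IH].
  rewrite (_ : (fun _ => _) = cst 0); first exact: cst_continuous.
  by apply/funext => y; rewrite big_nil.
rewrite (_ : (fun _ => _) =
  fun y => (if P a then f a y else 0) + \sum_(i <- s | P i) f i y).
  by apply: continuous_add => //; case: (P a) => //; exact: cst_continuous.
by apply/funext => y; rewrite big_cons; case: (P a); rewrite ?add0r.
Qed.

Lemma continuous_scalel (V : normedModType R) f (a : V) :
  continuous f -> continuous (fun x => f x *: a).
Proof. by move=> cf x; exact: (@cvgZr_tmp _ _ _ (nbhs x) _ f _ a (cf x)). Qed.

End continuous_pointwise.

(** * Integration over row vectors *)

Section tuple_integral.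
Context {R : realType}.
Local Notation RT := (measurableTypeR R).
Local Notation mu n := (@lebesgue_measure_tuple R n).
Local Open Scope ereal_scope.

(** Tonelli: the measure on longer tuples is the pushforward of a product measure under
    [tuple_cons]. Inductions on the dimension rest on this. *)
Lemma ge0_integral_tuple_cons n (f : n.+1.-tuple RT -> \bar R) :
  measurable_fun [set: n.+1.-tuple RT] f -> (forall t, 0 <= f t) ->
  \int[mu n.+1]_t f t =
  \int[@lebesgue_measure R]_x \int[mu n]_t f (tuple_cons (x, t)).
Proof.
move=> mf f0; rewrite /=.
rewrite (ge0_integral_pushforward (@measurable_tuple_cons R n) (lebesgue_measure \x mu n)%E)//.
rewrite (@fubini_tonelli1 _ _ _ _ _ lebesgue_measure (mu n) (f \o @tuple_cons R n))//.
  apply: measurableT_comp => //; exact: measurable_tuple_cons.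
by move=> x; exact: f0.
Qed.

(** [l] times the pushforward of Lebesgue measure under x -> a + l x agrees with Lebesgue measure on
    the intervals ]x, y], hence on all measurable sets by uniqueness. *)
Lemma ge0_integral_affine1 (a l : R) (f : RT -> \bar R) : (0 < l)%R ->
  measurable_fun [set: RT] f -> (forall x, 0 <= f x) ->
  \int[@lebesgue_measure R]_x f x =
  l%:E * \int[@lebesgue_measure R]_x f (a + l * x)%R.
Proof.
move=> l0 mf f0.
have mphi : measurable_fun [set: RT] (fun x : RT => (a + l * x)%R : RT).
  apply: continuous_measurable_fun => x; apply: cvgD; first exact: cvg_cst.
  by apply: cvgMr; exact: cvg_id.
have <- := @ge0_integral_pushforward _ _ _ _ _ _ mphi lebesgue_measure setT f measurableT mf (in1W f0).
have l0' : (0 <= l)%R by exact: ltW.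
pose l' : {nonneg R} := NngNum l0'.
rewrite -(ge0_integral_mscale (pushforward lebesgue_measure _) measurableT l')//.
apply: eq_measure_integral => A mA _.
rewrite -[LHS]/(lebesgue_measure A).
apply: (lebesgue_measure_unique (mu := mscale l' (pushforward lebesgue_measure (fun x : RT => (a + l * x)%R : RT)))) => // _ [[x y]] _ <-.
rewrite -[RHS]/(l%:E * lebesgue_measure
  ((fun x0 : RT => (a + l * x0)%R) @^-1` `]x, y]%classic)).
rewrite (_ : _ @^-1` _ = `]((x - a) / l)%R, ((y - a) / l)%R]%classic :> set R); last first.
  apply/seteqP; split => t /=; rewrite !in_itv/= ltr_pdivrMr// ler_pdivlMr//;
    by rewrite ltrBlDl lerBrDl (mulrC t).
rewrite !lebesgue_measure_itv/= !lte_fin ltr_pM2r ?invr_gt0// ltrD2r.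
case: ifPn => _; last by rewrite mule0.
rewrite -EFinD -EFinM; congr EFin.
by field; rewrite gt_eqF.
Qed.

Lemma tnth_tuple_cons0 n (p : RT * n.-tuple RT) : tnth (tuple_cons p) ord0 = p.1.
Proof. exact: tnth0. Qed.

Lemma tnth_tuple_consS n (p : RT * n.-tuple RT) j :
  tnth (tuple_cons p) (lift ord0 j) = tnth p.2 j.
Proof. exact: tnthS. Qed.

Definition affine_tuple n (a : n.-tuple RT) (l : R) (t : n.-tuple RT)
    : n.-tuple RT := [tuple (tnth a i + l * tnth t i)%R : RT | i < n].

Lemma measurable_affine_tuple n (a : n.-tuple RT) l :
  measurable_fun [set: n.-tuple RT] (affine_tuple a l).
Proof.
apply/measurable_fun_tnthP => i.
rewrite (_ : _ \o _ = fun t => (tnth a i + l * tnth t i)%R); last first.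
  by apply/funext => t /=; rewrite tnth_mktuple.
apply: measurable_funD => //; apply: measurable_funM => //.
exact: measurable_tnth.
Qed.

Lemma ge0_integral_affine n (a : n.-tuple RT) (l : R)
    (f : n.-tuple RT -> \bar R) : (0 < l)%R ->
  measurable_fun [set: n.-tuple RT] f -> (forall t, 0 <= f t) ->
  \int[mu n]_t f t = (l ^+ n)%:E * \int[mu n]_t f (affine_tuple a l t).
Proof.
elim: n a f => [|n IH] a f l0 mf f0.
  rewrite expr0 mul1e; apply: eq_integral => t _; congr f.
  by apply: eq_from_tnth; case.
rewrite ge0_integral_tuple_cons// ge0_integral_tuple_cons//; last first.
  apply: measurableT_comp => //; exact: measurable_affine_tuple.
pose a' : n.-tuple RT := [tuple of behead a].
have mfx x : measurable_fun [set: n.-tuple RT] (fun t => f (tuple_cons (x, t))).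
  apply: (@measurableT_comp _ _ _ _ _ _ f) => //.
  exact: (measurable_cons (measurable_cst x) (@measurable_id _ _ _)).
under eq_integral do rewrite (IH a')//.
(* The inner integral must be a measurable function of the head before the scalar can be pulled out
   and the one-dimensional substitution applied. *)
have mG : measurable_fun [set: RT]
    (fun x => \int[mu n]_t f (tuple_cons (x, affine_tuple a' l t))).
  apply: (@measurable_fun_fubini_tonelli_F _ _ _ _ _ (mu n)
    (fun p : RT * n.-tuple RT => f (tuple_cons (p.1, affine_tuple a' l p.2)))).
    apply: (@measurableT_comp _ _ _ _ _ _ f) => //.
    apply: measurable_cons; first exact: measurable_fst.
    apply: (@measurableT_comp _ _ _ _ _ _ (affine_tuple a' l)).
      exact: measurable_affine_tuple.
    exact: measurable_snd.
  by move=> p; exact: f0.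
rewrite ge0_integralZl//=; last 2 first.
- by move=> x _; exact: integral_ge0.
- by rewrite lee_fin exprn_ge0// ltW.
rewrite (@ge0_integral_affine1 (tnth a ord0) l (fun x => \int[mu n]_t f (tuple_cons (x, affine_tuple a' l t))))//; last first.
  by move=> x; exact: integral_ge0.
rewrite muleA -EFinM -exprSr; congr (_ * _).
apply: eq_integral => x _; apply: eq_integral => t _; congr f.
apply: eq_from_tnth => i; rewrite tnth_mktuple.
case: (unliftP ord0 i) => [j ->|->]; last first.
  by rewrite !tnth_tuple_cons0; exact: erefl.
rewrite !tnth_tuple_consS tnth_mktuple tnth_behead.
have -> : inord j.+1 = lift ord0 j by apply/val_inj; rewrite /= inordK ?ltnS ?ltn_ord.
exact: erefl.
Qed.

End tuple_integral.

Section row_vectors.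
Context {R : realType}.
Local Notation RT := (measurableTypeR R).

Definition row_of n (t : n.-tuple RT) : 'rV[R]_n := \row_i tnth t i.

Lemma ler_coord_norm n (x : 'rV[R]_n) i : `|x 0 i| <= `|x|.
Proof.
rewrite [leRHS]/Num.norm/= mx_normrE.
exact: (@le_bigmax _ _ _ 0 (fun ij : 'I_1 * 'I_n => `|x ij.1 ij.2|) (0, i)).
Qed.

Lemma rV_norm_le n (x : 'rV[R]_n) e : 0 <= e ->
  (forall i, `|x 0 i| <= e) -> `|x| <= e.
Proof.
move=> e0 xe; rewrite [leLHS]/Num.norm/= mx_normrE.
by apply: bigmax_le => // -[i j] _; rewrite ord1.
Qed.

(* The Borel sets of 'rV[R]_n are not related to the product sigma-algebra of
   tuples, so f is approximated by its values on grids of mesh 1 / (m + 1). *)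
Lemma measurable_continuous_row n (f : 'rV[R]_n -> R) : continuous f ->
  measurable_fun [set: n.-tuple RT] (fun t => f (row_of t)).
Proof.
move=> cf.
pose g m (z : n.-tuple int) : 'rV[R]_n := \row_i ((tnth z i)%:~R / m.+1%:R).
pose fl m (t : n.-tuple RT) : n.-tuple int :=
  [tuple Num.floor (m.+1%:R * tnth t i) | i < n].
apply: (@measurable_fun_cvg _ _ _ _ (fun m t => f (g m (fl m t)))).
  move=> m _ B mB; rewrite setTI.
  (* The rounded function factors through the countable grid, so the preimage is a countable union
     of boxes. Continuity of [f] enters only in the pointwise limit below. *)
  rewrite (_ : _ @^-1` B =
      \bigcup_(z in [set z | B (f (g m z))]) [set t | fl m t = z]); last first.
    by apply/seteqP; split => [t Bt|t [z Bz /= ->//]]; exists (fl m t).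
  rewrite bigcup_mkcond; apply: countable_bigcupT_measurable => // z.
  case: ifPn => // _.
  rewrite (_ : [set t | _] = \bigcap_(i in [set: 'I_n])
      ((fun t : n.-tuple RT => tnth t i) @^-1`
       `[(tnth z i)%:~R / m.+1%:R, (tnth z i + 1)%:~R / m.+1%:R[)); last first.
    have E i (t : n.-tuple RT) : (Num.floor (m.+1%:R * tnth t i) == tnth z i) =
       (tnth t i \in `[(tnth z i)%:~R / m.+1%:R, (tnth z i + 1)%:~R / m.+1%:R[).
      by rewrite in_itv/= floor_eq ler_pdivrMr// ltr_pdivlMr// mulrC.
    apply/seteqP; split => t /= => [zE i _|zE].
      by rewrite /= -E -zE tnth_mktuple.
    apply: eq_from_tnth => i; apply/eqP; rewrite tnth_mktuple E.
    exact: (zE i).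
  apply: fin_bigcap_measurable; first exact: finite_finset.
  move=> i _; rewrite -[X in measurable X]setTI; apply: measurable_tnth => //.
move=> t _.
apply: (@cvg_comp _ _ _ (fun m => g m (fl m t)) f _ (nbhs (row_of t))); last exact: cf.
apply/cvgrPdist_le => e e0.
near=> m; apply: rV_norm_le; first exact: ltW.
move=> i; rewrite !mxE tnth_mktuple.
have m0 : 0 < m.+1%:R :> R by [].
set s := tnth t i.
have -> : s - (Num.floor (m.+1%:R * s))%:~R / m.+1%:R =
   (m.+1%:R * s - (Num.floor (m.+1%:R * s))%:~R) / m.+1%:R.
  by field; rewrite gt_eqF.
rewrite ger0_norm; last by rewrite divr_ge0// subr_ge0 floor_le.
apply: (@le_trans _ _ m.+1%:R^-1).
  rewrite ler_piMl// lerBlDr; have := floorD1_gt (m.+1%:R * s).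
  by rewrite intrD addrC => /ltW.
apply/ltW; near: m; exact: (near_infty_natSinv_lt (PosNum e0)).
Unshelve. all: by end_near. Qed.

End row_vectors.

(** * Directional derivatives as limits of difference quotients *)

Section directional_derivatives.
Context {R : realType}.

Lemma is_derive_cvg (V W : normedModType R) (f : V -> W) x v l :
  h^-1 *: (f (h *: v + x) - f x) @[h --> (0:R)^'] --> l -> is_derive x v f l.
Proof.
move=> fl; apply: DeriveDef; first by apply/cvg_ex; exists l.
exact: cvg_lim fl.
Qed.

Lemma cvg_is_derive (V W : normedModType R) (f : V -> W) x v l :
  is_derive x v f l ->
  h^-1 *: (f (h *: v + x) - f x) @[h --> (0:R)^'] --> l.
Proof. by move=> [df <-]; exact: df. Qed.

Lemma is_derive_line (V W : normedModType R) (f : V -> W) x v (s : R) l :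
  is_derive (s *: v + x) v f l -> is_derive s 1 (fun h => f (h *: v + x)) l.
Proof.
move=> /cvg_is_derive fl; apply: is_derive_cvg; apply: cvg_trans fl.
apply: near_eq_cvg; apply: nearW => h /=.
by rewrite -[_%:A]/(h * 1) mulr1 scalerDl addrA.
Qed.

End directional_derivatives.

Section integral_row.
Context {R : realType}.
Local Notation RT := (measurableTypeR R).
Local Notation mu n := (@lebesgue_measure_tuple R n).

Definition Int n (f : 'rV[R]_n -> R) : R :=
  \int[mu n]_t f (row_of t).

(* The weight is integrable because it is at most prod_i 1 / (1 + x_i^2). *)
Definition integrand n (f : 'rV[R]_n -> R) :=
  continuous f /\
  exists C, forall x, `|f x| <= C * (1 + `|x|) ^ (- (2 * n)%:Z).

Lemma integral_oneDsqrV :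
  (\int[@lebesgue_measure R]_x (oneDsqr x)^-1%:E = pi%:E)%E.
Proof.
rewrite ge0_symfun_integralT//=.
- rewrite (_ : [set x | _] = `[0, +oo[%classic); last first.
    by apply/seteqP; split => x/=; rewrite in_itv/= andbT.
  rewrite (_ : (fun x => _) = (fun x : R => (oneDsqr x)^-1%:E)) //.
  by rewrite integral0y_oneDsqr -EFinM mulrCA divff// mulr1.
- exact: continuous_oneDsqrV.
- by move=> x/=; rewrite /oneDsqr sqrrN.
Qed.

Lemma measurable_prod_oneDsqrV n : measurable_fun [set: n.-tuple RT]
  (fun t => (\prod_i (oneDsqr (tnth t i))^-1)%:E).
Proof.
apply/measurable_EFinP.
apply: (@measurable_prod _ _ _ _ _ _ (fun i t => (oneDsqr (tnth t i))^-1)) => i _.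
apply: (@measurableT_comp _ _ _ _ _ _ (fun x : R => (oneDsqr x)^-1)) => //.
  apply: continuous_measurable_fun; exact: continuous_oneDsqrV.
exact: measurable_tnth.
Qed.

Lemma integral_prod_oneDsqrV n :
  (\int[mu n]_t (\prod_i (oneDsqr (tnth t i))^-1)%:E = (pi ^+ n)%:E)%E.
Proof.
have P0 m (t : m.-tuple RT) : (0 <= (\prod_i (oneDsqr (tnth t i))^-1)%:E)%E.
  by rewrite lee_fin prodr_ge0.
elim: n => [|n IH].
  rewrite expr0 /=; under eq_integral do rewrite big_ord0.
  by rewrite integral_cst//= diracT mule1.
rewrite ge0_integral_tuple_cons//; last exact: measurable_prod_oneDsqrV.
transitivity (\int[@lebesgue_measure R]_x ((pi ^+ n)%:E * (oneDsqr x)^-1%:E))%E.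
  apply: eq_integral => x _; rewrite muleC -IH -ge0_integralZl//; last exact: measurable_prod_oneDsqrV.
  apply: eq_integral => t _; rewrite big_ord_recl EFinM tnth_tuple_cons0.
  congr (_ * _%:E)%E; apply: eq_bigr => i _.
  by rewrite tnth_tuple_consS.
rewrite ge0_integralZl//; last 2 first.
- apply/measurable_EFinP; apply: continuous_measurable_fun.
  exact: continuous_oneDsqrV.
- by rewrite lee_fin exprn_ge0// pi_ge0.
by rewrite integral_oneDsqrV -EFinM exprSr.
Qed.

Lemma oneDnorm_gt0 n (x : 'rV[R]_n) : 0 < 1 + `|x|.
Proof. by rewrite ltr_pwDl. Qed.
Local Hint Resolve oneDnorm_gt0 : core.

Lemma continuous_oneDnorm_exp n (o : int) :
  continuous (fun x : 'rV[R]_n => (1 + `|x|) ^ o).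
Proof.
have cX m : continuous (fun x : 'rV[R]_n => (1 + `|x|) ^+ m).
  apply: continuous_exprn; apply: continuous_add; first exact: cst_continuous.
  exact: norm_continuous.
case: o => m; first exact: cX.
by apply: continuous_inv => // x; rewrite gt_eqF// exprn_gt0.
Qed.

Lemma integrable_weight n : (mu n).-integrable setT
  (EFin \o (fun t => (1 + `|row_of t|) ^ (- (2 * n)%:Z))).
Proof.
apply/integrableP; split.
  apply/measurable_EFinP; apply: (@measurable_continuous_row _ _ (fun x => (1 + `|x|) ^ (- (2 * n)%:Z))).
  exact: continuous_oneDnorm_exp.
apply: (@le_lt_trans _ _ (pi ^+ n)%:E); last exact: ltry.
rewrite -integral_prod_oneDsqrV; apply: ge0_le_integral => //.
- apply/measurable_EFinP; apply/measurableT_comp => //.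
  apply: (@measurable_continuous_row _ _ (fun x => (1 + `|x|) ^ (- (2 * n)%:Z))); exact: continuous_oneDnorm_exp.
- exact: measurable_prod_oneDsqrV.
- move=> t _; rewrite lee_fin ger0_norm; last by rewrite exprz_ge0// ltW.
  have P0 : 0 < \prod_i oneDsqr (tnth t i).
    by apply: prodr_gt0 => i _; rewrite (lt_le_trans ltr01).
  rewrite -exprnN prodfV lef_pV2 ?posrE ?exprn_gt0//.
  (* (1 + |x|)^(2n) is read as n factors (1 + |x|)^2, one against each factor 1 + x_i^2. *)
  rewrite exprM -[X in _ <= _ ^+ X]card_ord -prodr_const; apply: ler_prod => i _.
  rewrite (le_trans ler01)//=.
  rewrite /oneDsqr sqrrD expr1n -addrA lerD2l.
  have := ler_coord_norm (row_of t) i; rewrite mxE => ti.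
  apply: (@le_trans _ _ (`|row_of t| ^+ 2)); last by rewrite lerDr mul1r mulrn_wge0.
  by rewrite -real_normK ?num_real// lerXn2r ?nnegrE.
Qed.

Lemma integrand_integrable n (f : 'rV[R]_n -> R) : integrand f ->
  (mu n).-integrable setT (EFin \o (fun t => f (row_of t))).
Proof.
move=> [cf [C fC]].
apply: (@le_integrable _ _ _ (mu n) setT measurableT _
  (EFin \o (fun t => C * (1 + `|row_of t|) ^ (- (2 * n)%:Z)))).
- by apply/measurable_EFinP; exact: measurable_continuous_row.
- by move=> t _; rewrite /= lee_fin (le_trans (fC _))// ler_norm.
- exact: (integrableZl measurableT C (integrable_weight n)).
Qed.

Lemma integrandD n (f g : 'rV[R]_n -> R) :
  integrand f -> integrand g -> integrand (fun x => f x + g x).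
Proof.
move=> [cf [C fC]] [cg [D gD]]; split.
  exact: continuous_add.
exists (C + D) => x; rewrite mulrDl (le_trans (ler_normD _ _))// lerD//.
Qed.

Lemma integrandMb n (f g : 'rV[R]_n -> R) : continuous g ->
  (exists C, forall x, `|g x| <= C) ->
  integrand f -> integrand (fun x => g x * f x).
Proof.
move=> cg [C gC] [cf [D fD]]; split.
  exact: continuous_mul.
exists (C * D) => x; rewrite normrM -mulrA ler_pM//.
Qed.

Lemma integrandZ n c (f : 'rV[R]_n -> R) :
  integrand f -> integrand (fun x => c * f x).
Proof.
apply: integrandMb; first by exact: cst_continuous.
by exists `|c|.
Qed.

Lemma integrandN n (f : 'rV[R]_n -> R) :
  integrand f -> integrand (fun x => - f x).
Proof.
move=> /(integrandZ (-1)); rewrite (_ : (fun x => -1 * f x) = fun x => - f x)//.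
by apply/funext => x; rewrite mulN1r.
Qed.

Lemma integrandB n (f g : 'rV[R]_n -> R) :
  integrand f -> integrand g -> integrand (fun x => f x - g x).
Proof. by move=> fi /integrandN gi; exact: integrandD. Qed.

Lemma integrand0 n : integrand (fun _ : 'rV[R]_n => 0 : R).
Proof.
by split; [exact: cst_continuous|exists 0 => x; rewrite normr0 mul0r].
Qed.

Lemma integrand_sum n I (s : seq I) (P : pred I) (f : I -> 'rV[R]_n -> R) :
  (forall i, integrand (f i)) -> integrand (fun x => \sum_(i <- s | P i) f i x).
Proof.
move=> fi; elim: s => [|a s IH].
  rewrite (_ : (fun x => _) = (fun _ : 'rV[R]_n => 0 : R)); first exact: integrand0.
  by apply/funext => x; rewrite big_nil.
rewrite [X in integrand X](_ : _ = fun x =>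
    (if P a then f a x else 0) + \sum_(i <- s | P i) f i x); last first.
  by apply/funext => x; rewrite big_cons; case: ifP; rewrite ?add0r.
by apply: integrandD => //; case: (P a) => //; exact: integrand0.
Qed.

Lemma integrand_norm n (f : 'rV[R]_n -> R) :
  integrand f -> integrand (fun x => `|f x|).
Proof.
move=> [cf [C fC]]; split; last by exists C => x; rewrite normr_id.
exact: continuous_abs.
Qed.

Lemma le_integrand n (f g : 'rV[R]_n -> R) : continuous f -> integrand g ->
  (forall x, `|f x| <= `|g x|) -> integrand f.
Proof.
move=> cf [_ [C gC]] fg; split => //; exists C => x.
exact: le_trans (fg x) (gC x).
Qed.

Lemma IntD n (f g : 'rV[R]_n -> R) : integrand f -> integrand g ->
  Int (fun x => f x + g x) = Int f + Int g.
Proof.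
by move=> fi gi; rewrite /Int RintegralD//; exact: integrand_integrable.
Qed.

Lemma IntZ n c (f : 'rV[R]_n -> R) : integrand f ->
  Int (fun x => c * f x) = c * Int f.
Proof. by move=> fi; rewrite /Int RintegralZl//; exact: integrand_integrable. Qed.

Lemma IntN n (f : 'rV[R]_n -> R) : integrand f ->
  Int (fun x => - f x) = - Int f.
Proof.
move=> fi; rewrite -[RHS]mulN1r -IntZ//; congr Int.
by apply/funext => x; rewrite mulN1r.
Qed.

Lemma IntB n (f g : 'rV[R]_n -> R) : integrand f -> integrand g ->
  Int (fun x => f x - g x) = Int f - Int g.
Proof.
by move=> fi gi; rewrite IntD// ?IntN//; exact: integrandN.
Qed.

Lemma Int0 n : Int (fun _ : 'rV[R]_n => 0 : R) = 0.
Proof.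
by have := IntZ 0 (@integrand0 n); rewrite !mul0r.
Qed.

Lemma Int_sum n I (s : seq I) (P : pred I) (f : I -> 'rV[R]_n -> R) :
  (forall i, integrand (f i)) ->
  Int (fun x => \sum_(i <- s | P i) f i x) = \sum_(i <- s | P i) Int (f i).
Proof.
move=> fi; elim: s => [|a s IH].
  rewrite big_nil; apply: etrans (Int0 n); congr Int.
  by apply/funext => x; rewrite big_nil.
rewrite big_cons -IH; case: ifPn => Pa; last first.
  by congr Int; apply/funext => x; rewrite big_cons (negbTE Pa).
rewrite -IntD//; last exact: integrand_sum.
by congr Int; apply/funext => x; rewrite big_cons Pa.
Qed.

Lemma le_Int n (f g : 'rV[R]_n -> R) : integrand f -> integrand g ->
  (forall x, f x <= g x) -> Int f <= Int g.
Proof.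
move=> fi gi fg; rewrite /Int le_Rintegral//; exact: integrand_integrable.
Qed.

Lemma ler_norm_Int n (f : 'rV[R]_n -> R) : integrand f ->
  `|Int f| <= Int (fun x => `|f x|).
Proof.
move=> fi; rewrite /Int le_normr_Rintegral//; exact: integrand_integrable.
Qed.

Lemma Int_ge0 n (f : 'rV[R]_n -> R) : (forall x, 0 <= f x) -> 0 <= Int f.
Proof. by move=> f0; exact: Rintegral_ge0. Qed.

Lemma Int_bound n (f g : 'rV[R]_n -> R) : integrand f -> integrand g ->
  (forall x, `|f x| <= g x) -> `|Int f| <= Int g.
Proof.
move=> fi gi fg; apply: le_trans (ler_norm_Int fi) _.
by apply: le_Int => //; exact: integrand_norm.
Qed.

Lemma integral_Rn_Int n (f : 'rV[R]_n -> R) : integrand f ->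
  integral_Rn (fun x => (f x)%:E) = (Int f)%:E.
Proof.
move=> fi; rewrite /Int /Rintegral fineK//.
exact/integrable_fin_num/integrand_integrable.
Qed.

End integral_row.

(** * Affine substitution, differentiation under the integral, integrals of derivatives *)

Section integral_calculus.
Context {R : realType}.
Local Notation RT := (measurableTypeR R).
Local Notation mu n := (@lebesgue_measure_tuple R n).
Local Hint Resolve oneDnorm_gt0 : core.

Lemma ler_exprzN (x y K : R) (m : nat) : 0 < x -> 0 < y -> 0 < K ->
  x <= K * y -> y ^ (- m%:Z) <= K ^+ m * x ^ (- m%:Z).
Proof.
move=> x0 y0 K0 xKy; rewrite -!exprnN -ler_pdivrMl ?exprn_gt0//.
rewrite -invfM -exprMn lef_pV2 ?posrE ?exprn_gt0 ?mulr_gt0//.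
by rewrite lerXn2r ?nnegrE// ltW// mulr_gt0.
Qed.

(** Solve z = a + l y for y. The constant depends only on [a] and [l], which makes the class
    [integrand] invariant under affine substitution. *)
Lemma oneDnorm_affine n (a y : 'rV[R]_n) (l : R) : 0 < l ->
  1 + `|y| <= (1 + (1 + `|a|) / l) * (1 + `|a + l *: y|).
Proof.
move=> l0; set z := a + l *: y.
have yz : `|y| <= (`|z| + `|a|) / l.
  rewrite ler_pdivlMr// -[X in _ * X]ger0_norm ?(ltW l0)// mulrC -normrZ.
  have -> : l *: y = z - a by rewrite /z addrC addKr.
  exact: ler_normB.
rewrite mulrDl mul1r (le_trans (lerD (lexx 1) yz))// -addrA lerD2l.
rewrite mulrAC ler_wpDl// ler_pM2r ?invr_gt0//.
by rewrite mulrDr mulr1 mulrDl mul1r [leRHS]addrC -addrA lerD2l ler_wpDl// ler_wpDl// mulr_ge0.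
Qed.

Lemma integrand_affine n (a : 'rV[R]_n) (l : R) (f : 'rV[R]_n -> R) : 0 < l ->
  integrand f -> integrand (fun y => f (a + l *: y)).
Proof.
move=> l0 [cf [C fC]]; split.
  apply: (@continuous_compose _ _ _ (fun y : 'rV[R]_n => a + l *: y) f) => //.
  apply: continuous_add; first exact: cst_continuous.
  exact: scaler_continuous.
have C0 : 0 <= C.
  have := le_trans (normr_ge0 _) (fC 0).
  by rewrite pmulr_lge0// exprz_gt0.
exists (C * (1 + (1 + `|a|) / l) ^+ (2 * n)) => y.
rewrite (le_trans (fC _))// -mulrA ler_wpM2l//.
apply: ler_exprzN => //; last exact: oneDnorm_affine.
by rewrite ltr_pwDl// divr_ge0// ltW.
Qed.

Lemma row_of_affine n (a : 'rV[R]_n) l (t : n.-tuple RT) :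
  row_of (affine_tuple [tuple a 0 i | i < n] l t) = a + l *: row_of t.
Proof. by apply/rowP => i; rewrite !mxE !tnth_mktuple. Qed.

Lemma Int_affine n (a : 'rV[R]_n) (l : R) (f : 'rV[R]_n -> R) : 0 < l ->
  integrand f -> Int f = l ^+ n * Int (fun y => f (a + l *: y)).
Proof.
move=> l0 fi.
have [cf _] := fi.
have fai := integrand_affine a l0 fi.
have ln : l ^+ n = fine (l ^+ n)%:E by [].
rewrite {1}ln -fineM ?(integrable_fin_num _ (integrand_integrable fai))//.
rewrite /Int /Rintegral; congr fine.
have mf := measurable_continuous_row cf.
rewrite integralE [in RHS]integralE.
rewrite (@ge0_integral_affine _ n [tuple a 0 i | i < n] l)//; last first.
  by apply: measurable_funepos; apply/measurable_EFinP.
rewrite (@ge0_integral_affine _ n [tuple a 0 i | i < n] l (_^\-)%E)//; last first.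
  by apply: measurable_funeneg; apply/measurable_EFinP.
pose g t := EFin (f (a + l *: row_of t)).
have pE t : (fun s => (f (row_of s))%:E)^\+%E
    (affine_tuple [tuple a 0 i | i < n] l t) = g^\+%E t.
  by rewrite !funeposE row_of_affine.
have nE t : (fun s => (f (row_of s))%:E)^\-%E
    (affine_tuple [tuple a 0 i | i < n] l t) = g^\-%E t.
  by rewrite !funenegE row_of_affine.
transitivity ((l ^+ n)%:E * (\int[mu n]_t g^\+ t) -
    (l ^+ n)%:E * (\int[mu n]_t g^\- t))%E.
  by congr (_ * _ - _ * _)%E; apply: eq_integral => t _; [exact: pE|exact: nE].
(* Distributivity in the extended reals requires the difference of positive and negative parts to be
   defined; integrability provides it. *)
by rewrite -muleBr// (integrable_add_def measurableT (integrand_integrable fai)).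
Qed.

(** Dominated differentiation along the line through [z] in direction [v]. Only shifts with |h| <= 1
    need a common majorant, since the derivative is taken at h = 0. *)
Lemma derive_Int n (Phi dPhi : 'rV[R]_n -> 'rV[R]_n -> R)
    (z v : 'rV[R]_n) (C : R) :
  (forall z, integrand (Phi z)) ->
  (forall z y, is_derive z v (Phi^~ y) (dPhi z y)) ->
  (forall (h : R) y, `|h| <= 1 ->
    `|dPhi (h *: v + z) y| <= C * (1 + `|y|) ^ (- (2 * n)%:Z)) ->
  is_derive z v (fun z => Int (Phi z)) (Int (dPhi z)).
Proof.
move=> iP dP bP; apply: is_derive_cvg.
have dl (x : R) (t : n.-tuple RT) : is_derive x (1 : R) (fun h => Phi (h *: v + z) (row_of t)) (dPhi (x *: v + z) (row_of t)).
  exact: is_derive_line.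
have dE (x : R) (t : n.-tuple RT) : partial1of2 (fun h (t : n.-tuple RT) => Phi (h *: v + z) (row_of t)) x t = dPhi (x *: v + z) (row_of t).
  by rewrite partial1of2E; apply: derive_val.
have E : Int (dPhi z) =
    \int[mu n]_y partial1of2 (fun h (t : n.-tuple RT) => Phi (h *: v + z) (row_of t)) 0 y.
  by apply: eq_Rintegral => t _; rewrite dE scale0r add0r.
rewrite E.
rewrite [X in X @ _ --> _](_ : _ = fun h : R => h^-1 *:
    (\int[mu n]_t Phi ((h + 0) *: v + z) (row_of t) -
     \int[mu n]_t Phi (0 *: v + z) (row_of t))); last first.
  by apply/funext => h; rewrite addr0 scale0r add0r.
apply: (@cvg_differentiation_under_integral R _ _ (mu n)
  (fun h t => Phi (h *: v + z) (row_of t)) setT measurableT 0 (-1) 1 _ _ _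
  (fun t => C * (1 + `|row_of t|) ^ (- (2 * n)%:Z)) _ _ _).
- by rewrite /= in_itv/= ltrN10 ltr01.
- move=> x _; exact: integrand_integrable.
- by move=> x y _ _; have [] := dl x y.
- move=> t; rewrite mulr_ge0//.
  have := bP 0 0; rewrite normr0 => /(_ ler01) /(le_trans (normr_ge0 _)).
  by rewrite pmulr_lge0// exprz_gt0.
- exact: (integrableZl measurableT C (@integrable_weight R n)).
- move=> x t; rewrite /= in_itv/= => /andP[x1 x2] _; rewrite dE.
  by apply: bP; rewrite ler_norml !ltW.
Qed.

(** By translation invariance z -> Int F(z + .) is constant, while its derivative along [v] at 0 is
    the integral of [dF]. No boundary terms or iterated integrals appear. *)
Lemma Int_derive0 n (F dF : 'rV[R]_n -> R) v : integrand F -> integrand dF ->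
  (forall x, is_derive x v F (dF x)) -> Int dF = 0.
Proof.
move=> iF idF dFE; have [_ [C dFC]] := idF.
have C0 : 0 <= C.
  have := le_trans (normr_ge0 _) (dFC 0).
  by rewrite pmulr_lge0// exprz_gt0.
suff D : is_derive (0 : 'rV[R]_n) v (fun z => Int (fun y => F (z + y)))
    (Int (fun y => dF (0 + y))).
  have cE : (fun z : 'rV[R]_n => Int (fun y => F (z + y))) = cst (Int F).
    apply/funext => z /=; rewrite [RHS](Int_affine z ltr01 iF) expr1n mul1r.
    by congr Int; apply/funext => y; rewrite scale1r.
  rewrite cE in D.
  have := etrans (esym (@derive_val _ _ _ _ _ _ _ D)) (derive_cst _ _ _).
  by move=> <-; congr Int; apply/funext => y; rewrite add0r.
(* For |h| <= 1 one has 1 + |y| <= (1 + |v|)(1 + |h v + y|), so the shift costs at most the factor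
   (1 + |v|)^(2n). *)
apply: (@derive_Int n (fun z y => F (z + y)) (fun z y => dF (z + y)) 0 v
  (C * (1 + `|v|) ^+ (2 * n))).
- move=> z; have := integrand_affine z ltr01 iF.
  by under eq_fun do rewrite scale1r.
- move=> z y; apply: is_derive_cvg; have /cvg_is_derive := dFE (z + y).
  by under eq_fun do rewrite addrA.
- move=> h y h1; rewrite addr0 (le_trans (dFC _))// -mulrA ler_wpM2l//.
  apply: ler_exprzN => //.
  rewrite mulrDl mul1r -addrA lerD2l.
  have : `|y| <= `|h *: v + y| + `|v|.
    rewrite -{1}(addrK (h *: v) y) (addrC y) (le_trans (ler_normB _ _))// lerD2l.
    by rewrite normrZ ler_piMl.
  move=> /le_trans; apply; rewrite lerD2l mulrDr mulr1 lerDl mulr_ge0//.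
Qed.

End integral_calculus.

(** * Symbols and oscillatory integrals *)

Lemma is_derive_linear {R : realType} (V : normedModType R) (f : V -> R) x v :
  (forall h y z, f (h *: y + z) = h * f y + f z) -> is_derive x v f (f v).
Proof.
move=> flin; apply: is_derive_cvg.
apply: cvg_near_cst; near=> h.
rewrite flin addrK -[_ *: _]/(h^-1 * (h * f v)) mulKf//.
by near: h; exact: nbhs_dnbhs_neq.
Unshelve. all: by end_near. Qed.

Section symbols.
Context {R : realType} {n : nat}.
Implicit Types (f g : 'rV[R]_n -> R) (o : int).
Local Hint Resolve oneDnorm_gt0 : core.

(* Derivatives up to order M keep the order of growth o: the decay gained by
   each differentiation of a classical symbol is not needed. *)
Fixpoint symb (M : nat) o f : Prop :=
  (exists C, forall x, `|f x| <= C * (1 + `|x|) ^ o) /\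
  match M with
  | 0 => continuous f
  | M'.+1 => (forall x, differentiable f x) /\ forall v, symb M' o ('D_v f)
  end.

Lemma symb_bound M o f : symb M o f ->
  exists2 C, 0 <= C & forall x, `|f x| <= C * (1 + `|x|) ^ o.
Proof.
case: M => [|M] [[C fC] _]; exists C => //;
  by have := le_trans (normr_ge0 _) (fC 0); rewrite pmulr_lge0// exprz_gt0.
Qed.

Lemma symb_continuous M o f : symb M o f -> continuous f.
Proof.
case: M => [[]//|M [_ [df _]] x]; exact: differentiable_continuous.
Qed.

Lemma symbS M o f : symb M.+1 o f -> symb M o f.
Proof.
elim: M f => [|M IH] f sf.
  by split; [have [C _ fC] := symb_bound sf; exists C|exact: symb_continuous sf].
by have [fC [df Df]] := sf; split => //; split => // v; exact/IH.
Qed.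

Lemma symbW M N o f : (N <= M)%N -> symb M o f -> symb N o f.
Proof.
move=> NM; rewrite -(subnK NM); elim: (M - N)%N => // m IH.
by rewrite addSn => /symbS.
Qed.

Lemma symb_le M o o' f : o <= o' -> symb M o f -> symb M o' f.
Proof.
move=> oo'; elim: M f => [|M IH] f sf.
all: have [C C0 fC] := symb_bound sf.
all: have fC' : exists C, forall x, `|f x| <= C * (1 + `|x|) ^ o'
  by exists C => x; rewrite (le_trans (fC x))// ler_wpM2l// ler_weXz2l// lerDl.
- by split => //; exact: symb_continuous sf.
- by have [_ [df Df]] := sf; split => //; split => // v; apply: IH; exact: Df.
Qed.

Lemma symb_derive M o f v : symb M.+1 o f -> symb M o ('D_v f).
Proof. by move=> [_ [_]]; exact. Qed.

Lemma symb_derivable M o f x v : symb M.+1 o f -> derivable f x v.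
Proof. by move=> [_ [df _]]; exact: diff_derivable. Qed.

Lemma symbD M o f g : symb M o f -> symb M o g -> symb M o (fun x => f x + g x).
Proof.
elim: M f g => [|M IH] f g sf sg.
all: have [C C0 fC] := symb_bound sf; have [D D0 gD] := symb_bound sg.
all: have fgC : exists C, forall x, `|f x + g x| <= C * (1 + `|x|) ^ o
  by exists (C + D) => x; rewrite mulrDl (le_trans (ler_normD _ _))// lerD.
- split => //; apply: continuous_add; [exact: symb_continuous sf|exact: symb_continuous sg].
- have [_ [df Df]] := sf; have [_ [dg Dg]] := sg.
  split => //; split => [x|v]; first exact: differentiableD.
  rewrite (_ : 'D_v _ = fun x => 'D_v f x + 'D_v g x).
    by apply: IH; [exact: Df|exact: Dg].
  by apply/funext => x; rewrite deriveD//; exact: diff_derivable.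
Qed.

Lemma symbM M o o' f g :
  symb M o f -> symb M o' g -> symb M (o + o') (fun x => f x * g x).
Proof.
elim: M f g => [|M IH] f g sf sg.
all: have [C C0 fC] := symb_bound sf; have [D D0 gD] := symb_bound sg.
all: have fgC : exists C, forall x, `|f x * g x| <= C * (1 + `|x|) ^ (o + o')
  by exists (C * D) => x; rewrite normrM expfzDr ?gt_eqF// mulrACA ler_pM.
- split => //; apply: continuous_mul; [exact: symb_continuous sf|exact: symb_continuous sg].
- have [_ [df Df]] := sf; have [_ [dg Dg]] := sg.
  split => //; split => [x|v]; first exact: differentiableM.
  rewrite (_ : 'D_v _ = fun x => f x * 'D_v g x + 'D_v f x * g x).
    apply: symbD; first by apply: IH; [exact: symbS|exact: Dg].
    by apply: IH; [exact: Df|exact: symbS].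
  apply/funext => x; rewrite (@deriveM _ _ f g)//; try exact: diff_derivable.
  by rewrite [_ *: 'D_v f x]mulrC.
Qed.

Lemma derive_cst_fun (c : R) v : 'D_v (fun _ : 'rV[R]_n => c) = fun=> 0.
Proof. by apply/funext => x; exact: derive_cst. Qed.

Lemma symb_cst M c : symb M 0 (fun=> c).
Proof.
have cC (d : R) : exists C, forall x : 'rV[R]_n, `|d| <= C * (1 + `|x|) ^ (0 : int).
  by exists `|d| => x; rewrite expr0z mulr1.
elim: M c => [|M IH] c; split => //; first exact: cst_continuous.
by split => [x|v]; [exact: differentiable_cst|rewrite derive_cst_fun].
Qed.

Lemma symbZ M o c f : symb M o f -> symb M o (fun x => c * f x).
Proof. by move=> sf; rewrite -(add0r o); apply: symbM => //; exact: symb_cst. Qed.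

Lemma symbN M o f : symb M o f -> symb M o (fun x => - f x).
Proof.
move=> /(symbZ (-1)); rewrite (_ : (fun x => -1 * f x) = fun x => - f x)//.
by apply/funext => x; rewrite mulN1r.
Qed.

Lemma symb_sum M o I (s : seq I) (P : pred I) (f : I -> 'rV[R]_n -> R) :
  (forall i, symb M o (f i)) ->
  symb M o (fun x => \sum_(i <- s | P i) f i x).
Proof.
move=> sf.
have s0 : symb M o (fun=> 0).
  elim: M {sf} => [|M IH]; split; try by exists 0 => x; rewrite normr0 mul0r.
    exact: cst_continuous.
  by split => [x|v]; [exact: differentiable_cst|rewrite derive_cst_fun].
elim: s => [|a s IH].
  by rewrite [X in symb _ _ X](_ : _ = fun=> 0)//; apply/funext => x; rewrite big_nil.
rewrite [X in symb _ _ X](_ : _ = fun x =>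
    (if P a then f a x else 0) + \sum_(i <- s | P i) f i x); last first.
  by apply/funext => x; rewrite big_cons; case: ifP; rewrite ?add0r.
by apply: symbD => //; case: (P a).
Qed.

Lemma symb_coord M i : symb M 1 (fun x : 'rV[R]_n => x 0 i).
Proof.
have cC : exists C, forall x : 'rV[R]_n, `|x 0 i| <= C * (1 + `|x|) ^ (1 : int).
  exists 1 => x; rewrite mul1r expr1z (le_trans (ler_coord_norm x i))//.
  by rewrite lerDr.
case: M => [|M]; split => //; first exact: coord_continuous.
split => [x|v]; first exact: differentiable_coord.
rewrite (_ : 'D_v _ = fun=> v 0 i); first by apply: (@symb_le _ 0) => //; exact: symb_cst.
apply/funext => x; apply: (@derive_val _ _ _ _ _ _ _ (_ : is_derive _ _ _ _)).
by apply: is_derive_linear => h y z; rewrite !mxE.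
Qed.

(** The derivative of 1 / f is -(1 / f)(1 / f) D_v f, of order -m - m + m = -m, so the induction on
    the number of derivatives closes without loss. *)
Lemma symb_inv M (m : nat) f :
  (forall x, 0 < f x) -> (forall M, symb M m f) ->
  (exists C, forall x, (1 + `|x|) ^+ m <= C * f x) ->
  symb M (- m%:Z) (fun x => (f x)^-1).
Proof.
move=> f0 sf [C fC].
have C0 : 0 < C.
  have := fC 0; rewrite normr0 addr0 expr1n => /(lt_le_trans ltr01).
  by rewrite pmulr_lgt0.
have cC : exists C, forall x, `|(f x)^-1| <= C * (1 + `|x|) ^ (- m%:Z).
  exists C => x; rewrite ger0_norm ?invr_ge0 ?(ltW (f0 x))// -exprnN.
  by rewrite ler_pdivlMr ?exprn_gt0// mulrC ler_pdivrMr.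
have fn0 x : f x != 0 by rewrite gt_eqF.
elim: M => [|M IH]; split => //.
  by apply: continuous_inv => //; exact: symb_continuous (sf 0).
have df x : differentiable f x by have [_ []] := sf 1.
split => [x|v].
  apply: (@differentiable_comp _ _ _ _ f (fun y : R => y^-1)) => //.
  exact: differentiable_Rinv.
rewrite (_ : 'D_v _ = fun x => - ((f x)^-1 * ((f x)^-1 * 'D_v f x))); last first.
  apply/funext => x; rewrite deriveV//; last exact: diff_derivable.
  by rewrite scaleNr mulrA -expr2 exprVn.
apply: symbN.
rewrite [X in symb _ X](_ : _ = - m%:Z + (- m%:Z + m%:Z)); last first.
  by rewrite addNr addr0.
by apply: symbM => //; apply: symbM => //; exact: symb_derive (sf M.+1).
Qed.

End symbols.

Section oscillatory_integrals.
Context {R : realType} {n : nat}.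
Implicit Types (z xi v : 'rV[R]_n) (f h : 'rV[R]_n -> R) (th : R).
Local Hint Resolve oneDnorm_gt0 : core.

Definition rdot z xi : R := \sum_i z 0 i * xi 0 i.

Lemma rdotC z xi : rdot z xi = rdot xi z.
Proof. by apply: eq_bigr => i _; rewrite mulrC. Qed.

Lemma rdot_linear z (c : R) xi v :
  rdot z (c *: xi + v) = c * rdot z xi + rdot z v.
Proof.
rewrite /rdot mulr_sumr -big_split; apply: eq_bigr => i _.
by rewrite !mxE mulrDr mulrCA.
Qed.

Lemma rdotZr z (c : R) xi : rdot z (c *: xi) = c * rdot z xi.
Proof. by rewrite /rdot mulr_sumr; apply: eq_bigr => i _; rewrite !mxE mulrCA. Qed.

Lemma rdotZl z (c : R) xi : rdot (c *: z) xi = c * rdot z xi.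
Proof. by rewrite rdotC rdotZr rdotC. Qed.

Lemma rdotB z z' xi : rdot (z - z') xi = rdot z xi - rdot z' xi.
Proof.
by rewrite rdotC addrC -scaleN1r rdot_linear mulN1r addrC !(rdotC xi).
Qed.

Lemma rdot_delta z i : rdot z (delta_mx 0 i) = z 0 i.
Proof.
rewrite /rdot (bigD1 i)//= big1 ?addr0 => [|j ji]; rewrite mxE eqxx/=.
  by rewrite eqxx mulr1.
by rewrite (negbTE ji) mulr0.
Qed.

Lemma norm_rdot_le z xi : `|rdot z xi| <= n%:R * (`|z| * `|xi|).
Proof.
apply: (le_trans (ler_norm_sum _ _ _)).
rewrite mulr_natl -[X in _ *+ X]card_ord -sumr_const.
by apply: ler_sum => i _; rewrite normrM ler_pM// ler_coord_norm.
Qed.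

Lemma continuous_rdot z : continuous (rdot z).
Proof.
apply: (@continuous_sum _ _ R _ _ _ (fun i xi => z 0 i * xi 0 i)) => i.
by apply: continuous_mul; [exact: cst_continuous|exact: coord_continuous].
Qed.

Lemma symb_rdot M z : symb M 1 (rdot z).
Proof.
apply: (@symb_sum _ _ _ _ _ _ _ (fun i xi => z 0 i * xi 0 i)) => i.
by apply: symbZ; exact: symb_coord.
Qed.

Lemma is_derive_cos_rdot z xi th v :
  is_derive xi v (fun xi => cos (rdot z xi + th))
    (rdot z v * cos (rdot z xi + th + pi / 2)).
Proof.
apply: is_derive_cvg.
have D : is_derive (0 : R) 1 (fun t : R => cos (t * rdot z v + (rdot z xi + th)))
    (rdot z v * cos (rdot z xi + th + pi / 2)).
  apply: is_derive_eq; rewrite mul0r add0r cosDpihalf.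
  by rewrite scale0r add0r addr0 -[_%:A]/(_ * 1) mulr1 mulrC.
have /cvg_is_derive := D; apply: cvg_trans; apply: near_eq_cvg.
by apply: nearW => t; rewrite addr0 rdot_linear -[_%:A]/(t * 1) mulr1 mul0r add0r addrA.
Qed.

Lemma continuous_cos_rdot z th : continuous (fun xi => cos (rdot z xi + th)).
Proof.
apply: (@continuous_compose _ _ _ (fun xi => rdot z xi + th) cos).
  by apply: continuous_add; [exact: continuous_rdot|exact: cst_continuous].
exact: continuous_cos.
Qed.

Lemma normr_cos_le1 (x : R) : `|cos x| <= 1.
Proof. by rewrite ler_norml cos_geN1 cos_le1. Qed.

Lemma cos_lipschitz (a b : R) : `|cos a - cos b| <= `|a - b|.
Proof.
wlog ab : a b / a < b.
  move=> W; have [ab|ba|->] := ltgtP a b; [exact: W| |by rewrite !subrr].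
  by rewrite distrC [leRHS]distrC W.
have [|c _ E] := @MVT R (@cos R) (fun x => - sin x) a b ab.
  exact/continuous_subspaceT/continuous_cos.
rewrite distrC E normrM normrN [leRHS]distrC ler_piMl//.
by rewrite ler_norml sin_geN1 sin_le1.
Qed.

Lemma integrand_cos h z th :
  integrand h -> integrand (fun xi => h xi * cos (rdot z xi + th)).
Proof.
move=> ih; under eq_fun do rewrite mulrC.
apply: integrandMb => //; first exact: continuous_cos_rdot.
by exists 1 => x; exact: normr_cos_le1.
Qed.

(* Real substitute for the Fourier transform of h: differentiating in z shifts
   the phase th by pi / 2 instead of producing a factor i. *)
Definition osc h th z : R := Int (fun xi => h xi * cos (rdot z xi + th)).

Lemma symb_integrand M h : symb M (- (2 * n)%:Z) h -> integrand h.
Proof.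
move=> sh; split; first exact: symb_continuous sh.
by have [C _ hC] := symb_bound sh; exists C.
Qed.

Lemma norm_osc_le h th z : integrand h ->
  `|osc h th z| <= Int (fun xi => `|h xi|).
Proof.
move=> ih; apply: Int_bound; [exact: integrand_cos|exact: integrand_norm|].
by move=> xi; rewrite normrM ler_piMr// normr_cos_le1.
Qed.

Lemma oscD h h' th z : integrand h -> integrand h' ->
  osc (fun xi => h xi + h' xi) th z = osc h th z + osc h' th z.
Proof.
move=> ih ih'; rewrite /osc -IntD; try exact: integrand_cos.
by congr Int; apply/funext => xi; rewrite mulrDl.
Qed.

Lemma oscZ c h th z : integrand h ->
  osc (fun xi => c * h xi) th z = c * osc h th z.
Proof.
move=> ih; rewrite /osc -IntZ; last exact: integrand_cos.
by congr Int; apply/funext => xi; rewrite mulrA.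
Qed.

Lemma osc_sum I (s : seq I) (P : pred I) (h : I -> 'rV[R]_n -> R) th z :
  (forall i, integrand (h i)) ->
  osc (fun xi => \sum_(i <- s | P i) h i xi) th z =
  \sum_(i <- s | P i) osc (h i) th z.
Proof.
move=> ih; rewrite /osc -Int_sum => [|i]; last exact: integrand_cos.
by congr Int; apply/funext => xi; rewrite mulr_suml.
Qed.

(** Differentiating in [z] brings down one factor of frequency. The extra order of decay of [h] pays
    for it, so that the differentiated integrand is still dominated by the weight. *)
Lemma is_derive_osc h th z v : symb 0 (- (2 * n).+1%:Z) h ->
  is_derive z v (osc h th) (osc (fun xi => rdot v xi * h xi) (th + pi / 2) z).
Proof.
move=> sh.
have ih : integrand h.
  by apply: (@symb_integrand 0); apply: symb_le sh; rewrite lerN2 lez_nat.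
have ivh : integrand (fun xi => rdot v xi * h xi).
  apply: (@symb_integrand 0).
  rewrite [X in symb _ X](_ : _ = 1 + - (2 * n).+1%:Z); last first.
    by rewrite -[(2 * n).+1]addn1 PoszD opprD addrCA subrr addr0.
  by apply: symbM => //; exact: symb_rdot.
have [_ [C vhC]] := ivh.
apply: (@derive_Int _ _ (fun z xi => h xi * cos (rdot z xi + th))
  (fun z xi => rdot v xi * h xi * cos (rdot z xi + (th + pi / 2))) z v C).
- by move=> z'; exact: integrand_cos.
- move=> z' xi.
  rewrite [X in is_derive _ _ X _](_ : _ = fun z => h xi * cos (rdot xi z + th)); last first.
    by apply/funext => y; rewrite rdotC.
  have := is_derive_cos_rdot xi z' th v => D.
  apply: is_derive_eq; rewrite -[_ *: _]/(_ * _) addrA (rdotC v) (rdotC z').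
  by rewrite mulrCA mulrA.
- move=> t xi _; rewrite normrM (le_trans _ (vhC xi))// ler_piMr//.
  exact: normr_cos_le1.
Qed.

(* Integration by parts in the frequency variable. *)
Lemma rdot_osc h th z v : symb 1 (- (2 * n)%:Z) h ->
  rdot z v * osc h th z = - osc ('D_v h) (th - pi / 2) z.
Proof.
move=> sh.
have ih : integrand h := symb_integrand sh.
have iDh : integrand ('D_v h) := symb_integrand (symb_derive v sh).
have iz : integrand (fun xi => rdot z v * (h xi * cos (rdot z xi + th))).
  by apply: integrandZ; exact: integrand_cos.
apply/eqP; rewrite -subr_eq0 opprK /osc -IntZ; last exact: integrand_cos.
rewrite -IntD//; last exact: integrand_cos.
apply/eqP; apply: (@Int_derive0 _ _ (fun xi => h xi * cos (rdot z xi + (th - pi / 2))) _ v).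
- exact: integrand_cos.
- by apply: integrandD => //; exact: integrand_cos.
- move=> xi.
  have D := is_derive_cos_rdot z xi (th - pi / 2) v.
  have Dh : is_derive xi v h ('D_v h xi).
    by apply: DeriveDef => //; exact: symb_derivable sh.
  apply: is_derive_eq; rewrite -!(addrA (rdot z xi)) subrK.
  by rewrite -[_ *: _]/(_ * _) -[X in _ + X]/(_ * _) mulrCA (mulrC (cos _)).
Qed.

(** Each power of |z| is traded for one frequency derivative of [h] along a coordinate, by
    [rdot_osc]. The phase changes at each step, hence the induction is over all [th]. *)
Lemma osc_decay K h : forall th, symb K (- (2 * n)%:Z) h ->
  exists2 C, 0 <= C & forall z, (1 + `|z|) ^+ K * `|osc h th z| <= C.
Proof.
elim: K h => [|K IH] h th sh.
  exists (Int (fun xi => `|h xi|)); first exact: Int_ge0.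
  move=> z; rewrite expr0 mul1r norm_osc_le//; exact: symb_integrand sh.
have [C C0 hC] := IH h th (symbS sh).
have /choice[D DP] : forall i : 'I_n, exists D : R, 0 <= D /\ forall z,
    (1 + `|z|) ^+ K * `|osc ('D_(delta_mx 0 i) h) (th - pi / 2) z| <= D.
  move=> i; have [D D0 hD] := IH _ (th - pi / 2) (symb_derive (delta_mx 0 i) sh).
  by exists D.
exists (C + \sum_i D i); first by rewrite addr_ge0// sumr_ge0// => i _; have [] := DP i.
move=> z; rewrite exprSr -mulrA mulrDl mul1r mulrDr lerD//.
have zle : `|z| * `|osc h th z| <=
    \sum_i `|osc ('D_(delta_mx 0 i) h) (th - pi / 2) z|.
  rewrite mulrC -[X in X * _]normr_id -normrZ; apply: rV_norm_le.
    by rewrite sumr_ge0.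
  move=> i; rewrite mxE normrM normr_id -normrM -rdot_delta mulrC.
  rewrite rdot_osc; last by apply: symbW sh.
  by rewrite normrN (bigD1 i)//= lerDl sumr_ge0.
apply: (le_trans (ler_wpM2l _ zle)); first by rewrite exprn_ge0// ltW.
by rewrite mulr_sumr ler_sum// => i _; have [_] := DP i.
Qed.

(** The cosine is 1-Lipschitz and |xi| |h(xi)| is integrable, so [osc h th] is Lipschitz. *)
Lemma continuous_osc h th : symb 0 (- (2 * n).+1%:Z) h -> continuous (osc h th).
Proof.
move=> sh.
have ih : integrand h.
  by apply: (@symb_integrand 0); apply: symb_le sh; rewrite lerN2 lez_nat.
have ivh : integrand (fun xi => `|xi| * `|h xi|).
  split; first by apply: continuous_mul; [exact: norm_continuous|
    apply: continuous_abs; exact: symb_continuous sh].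
  have [C C0 hC] := symb_bound sh; exists C => xi.
  rewrite ger0_norm ?mulr_ge0// mulrC (le_trans (ler_pM _ _ (hC xi) (_ : _ <= 1 + `|xi|)))//.
    by rewrite lerDr.
  rewrite -mulrA ler_wpM2l// -[X in _ * X]expr1z -expfzDr ?gt_eqF//.
  by rewrite -[(2 * n).+1]addn1 PoszD opprD -addrA addNr addr0.
set L := n%:R * Int (fun xi => `|xi| * `|h xi|).
have lip z z' : `|osc h th z - osc h th z'| <= L * `|z - z'|.
  rewrite /osc -IntB; try exact: integrand_cos.
  rewrite [leRHS](_ : _ = Int (fun xi => n%:R * `|z - z'| * (`|xi| * `|h xi|))); last first.
    by rewrite IntZ// /L mulrAC.
  apply: Int_bound.
  - by apply: integrandB; exact: integrand_cos.
  - exact: integrandZ.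
  - move=> xi; rewrite -mulrBr normrM.
    have := le_trans (cos_lipschitz (rdot z xi + th) (rdot z' xi + th)).
    rewrite opprD addrACA subrr addr0 -rdotB => /(_ _ (norm_rdot_le _ _)).
    move=> /(ler_wpM2l (normr_ge0 (h xi))) /le_trans; apply.
    by rewrite le_eqVlt; apply/predU1P; left; ring.
apply: lipschitz_continuous lip.
by rewrite mulr_ge0// Int_ge0// => xi; exact: mulr_ge0.
Qed.

End oscillatory_integrals.

(** * Systems of operators and cancellation *)

Section integration_by_parts.
Context {R : realType} {n : nat}.
Implicit Types (w f h : 'rV[R]_n -> R) (x y xi : 'rV[R]_n) (th l : R).
Local Hint Resolve oneDnorm_gt0 : core.

Definition bounded_support w := exists r : R, forall x, r < `|x| -> w x = 0.

Definition test_function w := smooth w /\ bounded_support w.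

Lemma bounded_support_bounded w : continuous w -> bounded_support w ->
  forall m, exists C, forall x, `|w x| <= C * (1 + `|x|) ^ (- m%:Z).
Proof.
move=> cw [r wr] m.
have [M wM] : exists M, forall x, `|w x| <= M.
  pose B : set 'rV[R]_n := [set x | `|x| <= `|r|].
  have cB : compact B.
    apply: bounded_closed_compact.
      exists `|r|; split; first exact: num_real.
      by move=> M rM x /le_trans; apply; exact: ltW.
    rewrite (_ : B = (fun x => `|x|) @^-1` [set y | y <= `|r|])//.
    by apply: closed_comp => [x _|]; [exact: norm_continuous|exact: closed_le].
  have [M [_ wM]] : bounded_set (w @` B).
    by apply/compact_bounded/continuous_compact => //; exact: continuous_subspaceT.
  exists (Num.max 0 (M + 1)) => x; have [xr|xr] := leP `|x| `|r|.
    by rewrite le_max; apply/orP; right; apply: wM; [rewrite ltrDl|exists x].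
  by rewrite wr ?normr0 ?le_max ?lexx// (le_lt_trans (ler_norm r)).
have M0 : 0 <= M by exact: le_trans (wM 0).
(* On the ball of radius |r| the weight is at least (1 + |r|)^(-m), and outside it [w] vanishes. The
   absolute value is there because [r] may be negative. *)
exists (M * (1 + `|r|) ^+ m) => x; have [xr|xr] := leP `|x| `|r|.
  rewrite (le_trans (wM x))// -mulrA ler_peMr// -exprnN ler_pdivlMr ?exprn_gt0//.
  by rewrite mul1r lerXn2r ?nnegrE ?addr_ge0// lerD2l.
rewrite wr ?normr0 ?(le_lt_trans (ler_norm r))//.
by rewrite !mulr_ge0 ?exprn_ge0 ?addr_ge0// exprz_ge0// addr_ge0.
Qed.

Lemma integrand_bounded_support w : continuous w -> bounded_support w -> integrand w.
Proof. by move=> cw bw; split => //; exact: bounded_support_bounded. Qed.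

Lemma bounded_supportM w f : bounded_support w -> bounded_support (fun y => w y * f y).
Proof. by move=> [r wr]; exists r => x rx; rewrite wr ?mul0r. Qed.

Lemma integrand_test w f : continuous w -> bounded_support w -> continuous f ->
  integrand (fun y => w y * f y).
Proof.
move=> cw bw cf; apply: integrand_bounded_support; first exact: continuous_mul.
exact: bounded_supportM.
Qed.

Lemma partials_cat s s' w : partials s (partials s' w) = partials (s ++ s') w.
Proof. by rewrite /partials /iter_derive map_cat foldr_cat. Qed.

Lemma test_function_partials s w : test_function w -> test_function (partials s w).
Proof.
move=> [sw [r wr]]; split; first by move=> s'; rewrite partials_cat.
elim: s => [|i s [r' IH]]; first by exists r.
exists r' => x rx; rewrite [LHS](_ : _ = 'D_(basis_vector i) (partials s w) x)//.
apply: (@derive_val _ _ _ _ _ _ _ (_ : is_derive _ _ _ _)).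
apply: is_derive_cvg; apply: cvg_near_cst.
(* For small h the point h v + x stays outside the ball of radius r', so the difference quotient is
   0 and the same radius serves the derivative. *)
near=> h; rewrite !IH ?subrr ?scaler0//.
set v := basis_vector i.
have hv : `|x| <= `|h *: v + x| + `|h| * (1 + `|v|).
  rewrite -{1}(addrK (h *: v) x) (addrC x) (le_trans (ler_normB _ _))// lerD2l.
  by rewrite normrZ ler_wpM2l// lerDr.
rewrite -(ltrD2r (`|h| * (1 + `|v|))) (lt_le_trans _ hv)// -ltrBrDl.
by rewrite -ltr_pdivlMr//; near: h; apply: dnbhs0_lt; rewrite divr_gt0// subr_gt0.
Unshelve. all: by end_near. Qed.

Lemma test_function_continuous w s : test_function w -> continuous (partials s w).
Proof. by case=> sw _; have [] := sw s. Qed.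

Definition mono (s : seq 'I_n) (xi : 'rV[R]_n) : R := \prod_(i <- s) xi 0 i.

Lemma symb_coordM h M i d : symb M (- d.+1%:Z) h ->
  symb M (- d%:Z) (fun xi : 'rV[R]_n => xi 0 i * h xi).
Proof.
move=> sh; rewrite [X in symb _ X](_ : _ = 1 + - d.+1%:Z); last first.
  by rewrite -addn1 PoszD opprD addrCA subrr addr0.
by apply: symbM => //; exact: symb_coord.
Qed.

Lemma symb_mono M s : symb M (size s)%:Z (mono s).
Proof.
elim: s => [|i s IH].
  rewrite [X in symb _ _ X](_ : _ = fun=> 1); first exact: symb_cst.
  by apply/funext => xi; rewrite /mono big_nil.
rewrite [X in symb _ _ X](_ : _ = fun xi : 'rV[R]_n => xi 0 i * mono s xi); last first.
  by apply/funext => xi; rewrite /mono big_cons.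
by rewrite -[size _]/(1 + size s)%N PoszD; apply: symbM => //; exact: symb_coord.
Qed.

Lemma symbZ_le M (d d' : nat) h : (d' <= d)%N ->
  symb M (- d%:Z) h -> symb M (- d'%:Z) h.
Proof. by move=> dd'; apply: symb_le; rewrite lerN2 lez_nat. Qed.

Lemma continuous_osc_affine h th x l : symb 0 (- (2 * n).+1%:Z) h ->
  continuous (fun y => osc h th (l *: (y - x))).
Proof.
move=> sh.
apply: (@continuous_compose _ _ _ (fun y : 'rV[R]_n => l *: (y - x)) (osc h th)).
  rewrite (_ : (fun y => _) = fun y : 'rV[R]_n => l *: y + - (l *: x)).
    by apply: continuous_add; [exact: scaler_continuous|exact: cst_continuous].
  by apply/funext => y; rewrite scalerBr.
exact: continuous_osc.
Qed.

(** The integral of the derivative of the product is 0. The chain rule through y -> l(y - x) gives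
    the factor [l], and the derivative of the kernel gives xi_i and the phase pi / 2. *)
Lemma Int_partial_osc w i h th x l : test_function w ->
  symb 0 (- (2 * n).+2%:Z) h ->
  Int (fun y => partials [:: i] w y * osc h th (l *: (y - x))) =
  - l * Int (fun y => w y * osc (fun xi : 'rV[R]_n => xi 0 i * h xi) (th + pi / 2) (l *: (y - x))).
Proof.
move=> tw sh.
have [sw bw] := tw.
have cw : continuous w := @test_function_continuous w [::] tw.
have c1w := @test_function_continuous w [:: i] tw.
have [_ b1w] := @test_function_partials [:: i] w tw.
have sh1 : symb 0 (- (2 * n).+1%:Z) h by apply: symbZ_le sh.
have sxh : symb 0 (- (2 * n).+1%:Z) (fun xi : 'rV[R]_n => xi 0 i * h xi) by exact: symb_coordM.
have c1 := @continuous_osc_affine _ th x l sh1.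
have c2 := @continuous_osc_affine _ (th + pi / 2) x l sxh.
apply/eqP; rewrite -subr_eq0 -IntZ; last exact: integrand_test.
rewrite -IntB; [|exact: integrand_test|apply: integrandZ; exact: integrand_test].
apply/eqP; apply: (@Int_derive0 _ _ (fun y => w y * osc h th (l *: (y - x))) _ (basis_vector i)).
- exact: integrand_test.
- apply: integrandB; [exact: integrand_test|apply: integrandZ; exact: integrand_test].
- move=> y.
  have Dw : is_derive y (basis_vector i) w (partials [:: i] w y).
    by apply: DeriveDef => //; have [_] := sw [::]; exact.
  have Do : is_derive y (basis_vector i) (fun y => osc h th (l *: (y - x)))
      (l * osc (fun xi : 'rV[R]_n => xi 0 i * h xi) (th + pi / 2) (l *: (y - x))).
    have -> : l * osc (fun xi : 'rV[R]_n => xi 0 i * h xi) (th + pi / 2) (l *: (y - x)) =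
        osc (fun xi => rdot (l *: basis_vector i) xi * h xi) (th + pi / 2) (l *: (y - x)).
      rewrite -oscZ; last by apply: symb_integrand; apply: symbZ_le sxh.
      congr osc; apply/funext => xi.
      by rewrite rdotZl rdotC rdot_delta mulrA.
    have := @is_derive_osc R n h th (l *: (y - x)) (l *: basis_vector i) sh1.
    move=> /cvg_is_derive D; apply: is_derive_cvg.
    apply: cvg_trans D; apply: near_eq_cvg; apply: nearW => t.
    by rewrite scalerA mulrC -scalerA -scalerDr addrA.
  apply: is_derive_eq; rewrite -[_ *: _]/(_ * _) -[X in _ + X = _]/(_ * _).
  by rewrite addrC mulrC mulNr opprK mulrCA.
Qed.

(** One order of decay of [h] is spent per derivative; order -(2n + 1) remains at the end, which
    keeps the last kernel continuous. *)
Lemma Int_partials_osc w s h th x l : test_function w ->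
  symb 0 (- (2 * n + (size s).+1)%:Z) h ->
  Int (fun y => partials s w y * osc h th (l *: (y - x))) =
  (- l) ^+ size s * Int (fun y => w y *
    osc (fun xi => mono s xi * h xi) (th + (size s)%:R * (pi / 2)) (l *: (y - x))).
Proof.
move=> tw; elim: s h th => [|i s IH] h th sh.
  rewrite expr0 mul1r mul0r addr0.
  rewrite (_ : (fun xi => mono [::] xi * h xi) = h)//.
  by apply/funext => xi; rewrite /mono big_nil mul1r.
have sxh : symb 0 (- (2 * n + (size s).+1)%:Z) (fun xi : 'rV[R]_n => xi 0 i * h xi).
  by apply: symb_coordM; rewrite -addnS.
rewrite (_ : partials (i :: s) w = partials [:: i] (partials s w)); last first.
  by rewrite partials_cat.
rewrite Int_partial_osc; last 2 first.
- exact: test_function_partials.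
- by apply: symbZ_le sh; rewrite !addnS !ltnS leq_addr.
rewrite IH// mulrA -exprS.
congr (_ * Int _); apply/funext => y; congr (_ * osc _ _ _).
  by apply/funext => xi; rewrite /mono big_cons mulrA [X in X * _]mulrC.
by rewrite /= -natr1; ring.
Qed.

End integration_by_parts.

Section cancellation.
Context {R : realType} {n : nat}.
Variables (Idx : finType) (la : Idx -> seq 'I_n) (k p q : nat).
Variable Am : Idx -> 'M[R]_(p, q).
Hypothesis size_la : forall a, size (la a) = k.
Implicit Types (u : 'I_p -> 'rV[R]_n -> R) (F h G : 'rV[R]_n -> R).
Implicit Types (x y xi z : 'rV[R]_n) (th l : R).
Local Hint Resolve oneDnorm_gt0 : core.

(* Vectors are rows, so A(xi) acts as right multiplication by system_symbol xi. *)
Definition system u (e : 'I_q) y : R :=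
  \sum_a \sum_v Am a v e * partials (la a) (u v) y.

Definition system_symbol xi : 'M[R]_(p, q) :=
  \matrix_(v, e) \sum_a Am a v e * mono (la a) xi.

Lemma continuous_system u e :
  (forall v, test_function (u v)) -> continuous (system u e).
Proof.
move=> tu; apply: (@continuous_sum _ _ R _ _ _ (fun a y => \sum_v Am a v e * partials (la a) (u v) y)) => a.
apply: (@continuous_sum _ _ R _ _ _ (fun v y => Am a v e * partials (la a) (u v) y)) => v.
apply: continuous_mul; [exact: cst_continuous|exact: test_function_continuous].
Qed.

Lemma bounded_support_sum I (s : seq I) (f : I -> 'rV[R]_n -> R) :
  (forall i, bounded_support (f i)) ->
  bounded_support (fun y => \sum_(i <- s) f i y).
Proof.
move=> bf; elim: s => [|a s [r IH]]; first by exists 0 => x _; rewrite big_nil.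
have [r' ar'] := bf a; exists (Num.max r r') => x.
by rewrite gt_max big_cons => /andP[rx r'x]; rewrite ar'// add0r IH.
Qed.

Lemma bounded_supportZ c (f : 'rV[R]_n -> R) :
  bounded_support f -> bounded_support (fun y => c * f y).
Proof. by move=> [r fr]; exists r => x rx; rewrite fr ?mulr0. Qed.

Lemma bounded_support_system u e :
  (forall v, test_function (u v)) -> bounded_support (system u e).
Proof.
move=> tu; apply: (@bounded_support_sum _ _ (fun a y => \sum_v Am a v e * partials (la a) (u v) y)) => a.
apply: (@bounded_support_sum _ _ (fun v y => Am a v e * partials (la a) (u v) y)) => v.
by apply: bounded_supportZ; case: (@test_function_partials _ _ (la a) _ (tu v)).
Qed.

Lemma integrand_system u e (phi : 'rV[R]_n -> R) :
  (forall v, test_function (u v)) -> continuous phi ->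
  integrand (fun y => system u e y * phi y).
Proof.
move=> tu; apply: integrand_test; first exact: continuous_system.
exact: bounded_support_system.
Qed.

(** All multi-indices have the same length k, so the factors (-l)^k and the phase shifts are common
    and the derivatives assemble into the symbol acting on the vector [g]. It is used twice: with a
    field killed by the symbol, and with a column of the inverse matrix. *)
Lemma system_duality u (g : 'I_q -> 'rV[R]_n -> R) th x l :
  (forall v, test_function (u v)) ->
  (forall e, symb 0 (- (2 * n + k.+1)%:Z) (g e)) ->
  \sum_e Int (fun y => system u e y * osc (g e) th (l *: (y - x))) =
  (- l) ^+ k * \sum_v Int (fun y => u v y *
    osc (fun xi => \sum_e system_symbol xi v e * g e xi)
        (th + k%:R * (pi / 2)) (l *: (y - x))).
Proof.
move=> tu sg.
have cu v : continuous (u v) by exact: (@test_function_continuous _ _ _ [::]).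
have bu v : bounded_support (u v) by case: (tu v).
have sg0 e : symb 0 (- (2 * n).+1%:Z) (g e).
  by apply: symbZ_le (sg e); rewrite addnS ltnS leq_addr.
have smg a e : symb 0 (- (2 * n).+1%:Z) (fun xi => mono (la a) xi * g e xi).
  (* The monomial costs k orders, which leaves -(2n + 1). *)
  rewrite [X in symb _ X](_ : _ = k%:Z + - (2 * n + k.+1)%:Z); last first.
    by rewrite addnC addSn -addnS PoszD opprD addrA subrr add0r.
  by apply: symbM => //; rewrite -(size_la a); exact: symb_mono.
pose J v a e := Int (fun y => u v y * osc (fun xi => mono (la a) xi * g e xi)
  (th + k%:R * (pi / 2)) (l *: (y - x))).
transitivity (\sum_e \sum_a \sum_v Am a v e * ((- l) ^+ k * J v a e)).
  apply: eq_bigr => e _.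
  have co := continuous_osc_affine (th := th) (x := x) (l := l) (sg0 e).
  have ip a v : integrand (fun y => partials (la a) (u v) y * osc (g e) th (l *: (y - x))).
    apply: integrand_test => //; first exact: test_function_continuous.
    by case: (@test_function_partials _ _ (la a) _ (tu v)).
  transitivity (Int (fun y => \sum_a \sum_v Am a v e *
      (partials (la a) (u v) y * osc (g e) th (l *: (y - x))))).
    congr Int; apply/funext => y; rewrite /system mulr_suml.
    by apply: eq_bigr => a _; rewrite mulr_suml; apply: eq_bigr => v _; rewrite mulrA.
  rewrite Int_sum => [|a]; last first.
    by apply: (@integrand_sum _ _ _ _ _ (fun v y => Am a v e * _)) => v; exact: integrandZ.
  apply: eq_bigr => a _; rewrite Int_sum => [|v]; last exact: integrandZ.
  apply: eq_bigr => v _; rewrite IntZ//; congr (_ * _).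
  by rewrite (Int_partials_osc _ _ _ (tu v)) size_la.
rewrite mulr_sumr.
transitivity (\sum_v (- l) ^+ k * \sum_e \sum_a Am a v e * J v a e); last first.
  apply: eq_bigr => v _; congr (_ * _).
  have co e a := continuous_osc_affine (th := th + k%:R * (pi / 2)) (x := x) (l := l) (smg a e).
  transitivity (Int (fun y => \sum_e \sum_a Am a v e * (u v y *
      osc (fun xi => mono (la a) xi * g e xi) (th + k%:R * (pi / 2)) (l *: (y - x))))).
    rewrite Int_sum => [|e]; last first.
      by apply: (@integrand_sum _ _ _ _ _ (fun a y => Am a v e * _)) => a; apply: integrandZ; exact: integrand_test.
    apply: eq_bigr => e _; rewrite Int_sum => [|a]; last by apply: integrandZ; exact: integrand_test.
    by apply: eq_bigr => a _; rewrite IntZ//; exact: integrand_test.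
  congr Int; apply/funext => y.
  transitivity (u v y * \sum_e \sum_a Am a v e *
      osc (fun xi => mono (la a) xi * g e xi) (th + k%:R * (pi / 2)) (l *: (y - x))).
    rewrite mulr_sumr; apply: eq_bigr => e _; rewrite mulr_sumr.
    by apply: eq_bigr => a _; rewrite mulrCA.
  congr (_ * _).
  have ig a e : integrand (fun xi => mono (la a) xi * g e xi).
    by apply: (@symb_integrand _ _ 0); apply: symbZ_le (smg a e).
  transitivity (osc (fun xi => \sum_e \sum_a Am a v e * (mono (la a) xi * g e xi))
      (th + k%:R * (pi / 2)) (l *: (y - x))).
    rewrite osc_sum => [|e]; last first.
      by apply: (@integrand_sum _ _ _ _ _ (fun a y => Am a v e * _)) => a; exact: integrandZ.
    apply: eq_bigr => e _; rewrite osc_sum => [|a]; last exact: integrandZ.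
    by apply: eq_bigr => a _; rewrite oscZ.
  congr osc; apply/funext => xi; apply: eq_bigr => e _.
  by rewrite mxE mulr_suml; apply: eq_bigr => a _; rewrite mulrA.
rewrite -[RHS]mulr_sumr [in RHS]exchange_big/= mulr_sumr.
apply: eq_bigr => e _; rewrite [in RHS]exchange_big/= mulr_sumr.
apply: eq_bigr => a _; rewrite mulr_sumr; apply: eq_bigr => v _.
by rewrite mulrCA.
Qed.

(* Vanishes at 0, which is what the canceling condition provides, and sums over
   dyadic dilations. *)
Definition omega (r : R) : R := r / (1 + r) ^+ 2.

(** [C] is uniform in [u], [F], [x] and [l]. [F] is any integrable majorant of all components of the
    system, so no norm on the target is involved yet; it becomes a multiple of |A(D)u|. *)
Definition kernel_bounded (T : ('I_p -> 'rV[R]_n -> R) -> 'rV[R]_n -> R -> R) :=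
  exists C, forall u F x l, 0 < l -> (forall v, test_function (u v)) ->
    integrand F -> (forall e y, `|system u e y| <= F y) ->
    `|T u x l| <= C * Int (fun y => F y * omega (l * `|y - x|)).

Lemma kernel_bounded_ext T T' : kernel_bounded T ->
  (forall u x l, 0 < l -> (forall v, test_function (u v)) -> T' u x l = T u x l) ->
  kernel_bounded T'.
Proof.
move=> [C TC] TT'; exists C => u F x l l0 tu iF fF; rewrite TT'//; exact: TC.
Qed.

Lemma kernel_boundedD T T' : kernel_bounded T -> kernel_bounded T' ->
  kernel_bounded (fun u x l => T u x l + T' u x l).
Proof.
move=> [C TC] [D TD]; exists (C + D) => u F x l l0 tu iF fF.
rewrite mulrDl (le_trans (ler_normD _ _))// lerD//; [exact: TC|exact: TD].
Qed.

Lemma kernel_boundedZ c T : kernel_bounded T ->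
  kernel_bounded (fun u x l => c * T u x l).
Proof.
move=> [C TC]; exists (`|c| * C) => u F x l l0 tu iF fF.
rewrite normrM -mulrA ler_wpM2l//; exact: TC.
Qed.

Lemma kernel_bounded0 : kernel_bounded (fun u x l => 0).
Proof. by exists 0 => u F x l _ _ _ _; rewrite normr0 mul0r. Qed.

Lemma kernel_bounded_sum I (s : seq I) (T : I -> _) :
  (forall i, kernel_bounded (T i)) ->
  kernel_bounded (fun u x l => \sum_(i <- s) T i u x l).
Proof.
move=> bT; elim: s => [|a s IH].
  by apply: kernel_bounded_ext kernel_bounded0 _ => u x l _ _; rewrite big_nil.
by apply: kernel_bounded_ext (kernel_boundedD (bT a) IH) _ => u x l _ _; rewrite big_cons.
Qed.

Lemma continuous_scaled_dist l x : continuous (fun y => l * `|y - x|).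
Proof.
apply: continuous_mul; first exact: cst_continuous.
apply: (@continuous_abs _ _ 'rV[R]_n (fun y => y - x)).
apply: (@continuous_add _ _ 'rV[R]_n (fun y => y) (fun=> - x)).
  by move=> y; exact: cvg_id.
exact: cst_continuous.
Qed.

Lemma continuous_omega l x : 0 < l -> continuous (fun y => omega (l * `|y - x|)).
Proof.
move=> l0; have cn := @continuous_scaled_dist l x.
apply: continuous_mul => //; apply: continuous_inv => [|y].
  by apply: continuous_exprn; apply: continuous_add => //; exact: cst_continuous.
by rewrite gt_eqF// exprn_gt0// ltr_pwDl// mulr_ge0// ltW.
Qed.

Lemma omega_ge0 (r : R) : 0 <= r -> 0 <= omega r.
Proof. by move=> r0; rewrite divr_ge0// exprn_ge0// addr_ge0. Qed.

Lemma omega_le1 (r : R) : 0 <= r -> omega r <= 1.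
Proof.
move=> r0; rewrite ler_pdivrMr ?mul1r ?exprn_gt0 ?ltr_pwDl//.
by nra.
Qed.

Lemma integrand_omega F l x : 0 < l -> integrand F ->
  integrand (fun y => F y * omega (l * `|y - x|)).
Proof.
move=> l0 iF; under eq_fun do rewrite mulrC.
apply: integrandMb => //; first exact: continuous_omega.
have ly y : 0 <= l * `|y - x| by rewrite mulr_ge0// ltW.
by exists 1 => y; rewrite ger0_norm ?omega_ge0 ?omega_le1.
Qed.

Lemma continuous_rdot_affine v x l : continuous (fun y => rdot (l *: (y - x)) v).
Proof.
apply: (@continuous_compose _ _ _ (fun y : 'rV[R]_n => l *: (y - x)) (rdot^~ v)).
  rewrite (_ : (fun y => _) = fun y : 'rV[R]_n => l *: y + - (l *: x)).
    by apply: continuous_add; [exact: scaler_continuous|exact: cst_continuous].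
  by apply/funext => y; rewrite scalerBr.
rewrite (_ : rdot^~ v = rdot v); first exact: continuous_rdot.
by apply/funext => z; rewrite rdotC.
Qed.

(** With z = l(y - x), the factor [rdot] contributes |z| and two frequency derivatives of [G]
    contribute (1 + |z|)^(-2): together this is [omega] of |z|. *)
Lemma kernel_bounded_rdot v G th e : symb 2 (- (2 * n).+1%:Z) G ->
  kernel_bounded (fun u x l => Int (fun y => system u e y *
    (rdot (l *: (y - x)) v * osc G th (l *: (y - x))))).
Proof.
move=> sG.
have sG0 : symb 0 (- (2 * n).+1%:Z) G by exact: symbW sG.
have [C C0 GC] := @osc_decay _ _ 2 G th (symbZ_le (leqnSn _) sG).
exists (n%:R * `|v| * C) => u F x l l0 tu iF fF.
have ly y : 0 <= l * `|y - x| by rewrite mulr_ge0// ltW.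
rewrite -IntZ; last exact: integrand_omega.
apply: Int_bound.
- apply: integrand_system => //; apply: continuous_mul; last exact: continuous_osc_affine.
  exact: continuous_rdot_affine.
- by apply: integrandZ; exact: integrand_omega.
- move=> y; set z := l *: (y - x).
  have zE : `|z| = l * `|y - x| by rewrite normrZ gtr0_norm.
  rewrite normrM mulrCA ler_pM// ?fF// normrM -zE.
  have oC : `|osc G th z| <= C / (1 + `|z|) ^+ 2.
    by rewrite ler_pdivlMr ?exprn_gt0// mulrC GC.
  rewrite (le_trans (ler_pM _ _ (norm_rdot_le z v) oC))// /omega.
  by rewrite le_eqVlt; apply/predU1P; left; ring.
Qed.

Definition iterD v j (f : 'rV[R]_n -> R) := iter j (fun f => 'D_v f) f.

Lemma symb_iterD v j M o f : symb (M + j) o f -> symb M o (iterD v j f).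
Proof.
elim: j M f => [|j IH] M f; first by rewrite addn0.
by rewrite /iterD iterS -addSnnS => /IH; exact: symb_derive.
Qed.

(* The moment identity behind cancellation, read on the frequency side: by the
   Leibniz rule c D^m h differs from (-1)^m (D^m c) h = (-1)^m m! c(v) h by
   derivatives along v, each of which becomes a factor rdot (y - x) v. *)
Lemma kernel_bounded_cancel (c : 'I_q -> 'rV[R]_n -> R) (m : nat) v h th :
  (forall e M, symb M m%:Z (c e)) ->
  (forall xi i, \sum_e system_symbol xi i e * c e xi = 0) ->
  (forall e xi, iterD v m (c e) xi = m`!%:R * c e v) ->
  symb (m + 2) (- (2 * n + k.+1 + m)%:Z) h ->
  kernel_bounded (fun u x l =>
    \sum_e c e v * Int (fun y => system u e y * osc h th (l *: (y - x)))).
Proof.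
move=> sc Pc cm sh.
(* The [X j] interpolate between the kernel c D^m h at j = 0 and (D^m c) h at j = m. In
   [symb (m + 2)] the two derivatives beyond m serve the decay in [kernel_bounded_rdot]. *)
pose X j u x l := \sum_e Int (fun y => system u e y *
  osc (fun xi => iterD v j (c e) xi * iterD v (m - j) h xi) th (l *: (y - x))).
have sG M j i e : (M + i <= m + 2)%N ->
    symb M (- (2 * n + k.+1)%:Z) (fun xi => iterD v j (c e) xi * iterD v i h xi).
  move=> Mi; rewrite [X in symb _ X](_ : _ = m%:Z + - (2 * n + k.+1 + m)%:Z).
    by apply: symbM; apply: symb_iterD; [exact: sc|exact: symbW sh].
  by rewrite [in RHS]PoszD opprD addrCA subrr addr0.
(* Here the functional is exactly 0: by duality the symbol falls on [c], which it annihilates. *)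
have X0 : kernel_bounded (X 0%N).
  apply: kernel_bounded_ext kernel_bounded0 _ => u x l l0 tu.
  rewrite /X system_duality//; last by move=> e; apply: sG; rewrite subn0 add0n leq_addr.
  rewrite big1 ?mulr0// => i _.
  rewrite (_ : (fun y => _) = fun=> 0) ?Int0//; apply/funext => y.
  rewrite (_ : (fun xi => _) = fun=> 0); last first.
    apply/funext => xi; under eq_bigr do rewrite mulrA.
    by rewrite -mulr_suml Pc mul0r.
  rewrite /osc (_ : (fun xi => _) = fun=> 0) ?Int0 ?mulr0//.
  by apply/funext => xi; rewrite mul0r.
(* By Leibniz, D_v of [G] is the sum of the terms j and j + 1, and its transform is minus [rdot]
   times the transform of [G]. Hence X (j + 1) is -X j minus a functional that is already
   bounded. *)
have XS j : (j < m)%N -> kernel_bounded (X j) -> kernel_bounded (X j.+1).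
  move=> jm bX.
  pose G e xi := iterD v j (c e) xi * iterD v (m - j.+1) h xi.
  have sGe e : symb 2 (- (2 * n + k.+1)%:Z) (G e).
    by apply: sG; rewrite addnC leq_add2r leq_subr.
  have sGe' e : symb 2 (- (2 * n).+1%:Z) (G e).
    by apply: symbZ_le (sGe e); rewrite addnS ltnS leq_addr.
  have bT := kernel_bounded_sum (index_enum 'I_q)
    (fun e => kernel_bounded_rdot v (th + pi / 2) e (sGe' e)).
  have := kernel_boundedD (kernel_boundedZ (-1) bX) (kernel_boundedZ (-1) bT).
  move=> /kernel_bounded_ext; apply => u x l l0 tu.
  rewrite !mulN1r -!sumrN -big_split; apply: eq_bigr => e _.
  have DG : 'D_v (G e) = fun xi => iterD v j (c e) xi * iterD v (m - j) h xi +
      iterD v j.+1 (c e) xi * iterD v (m - j.+1) h xi.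
    apply/funext => xi; rewrite (@deriveM _ _ (iterD v j (c e)) (iterD v (m - j.+1) h)).
    - rewrite -[_ *: _]/(_ * _) -[X in _ + X]/(_ * _) [X in _ + X]mulrC.
      by rewrite -(subnSK jm).
    - by apply: (@symb_derivable _ _ 0 m%:Z); apply: symb_iterD; exact: sc.
    - apply: (@symb_derivable _ _ 0 (- (2 * n + k.+1 + m)%:Z)); apply: symb_iterD.
      by apply: symbW sh; rewrite add1n subnSK// (leq_trans (leq_subr _ _))// leq_addr.
  have sga : symb 0 (- (2 * n).+1%:Z)
      (fun xi => iterD v j (c e) xi * iterD v (m - j) h xi).
    apply: (@symbZ_le _ _ _ (2 * n + k.+1)); first by rewrite addnS ltnS leq_addr.
    by apply: sG; rewrite add0n (leq_trans (leq_subr _ _))// leq_addr.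
  have sgb : symb 0 (- (2 * n).+1%:Z)
      (fun xi => iterD v j.+1 (c e) xi * iterD v (m - j.+1) h xi).
    apply: (@symbZ_le _ _ _ (2 * n + k.+1)); first by rewrite addnS ltnS leq_addr.
    by apply: sG; rewrite add0n (leq_trans (leq_subr _ _))// leq_addr.
  have ia : integrand (fun y => system u e y *
      osc (fun xi => iterD v j (c e) xi * iterD v (m - j) h xi) th (l *: (y - x))).
    by apply: integrand_system => //; exact: continuous_osc_affine.
  have it : integrand (fun y => system u e y *
      (rdot (l *: (y - x)) v * osc (G e) (th + pi / 2) (l *: (y - x)))).
    apply: integrand_system => //; apply: continuous_mul.
      exact: continuous_rdot_affine.
    by apply: continuous_osc_affine; exact: symbW (sGe' e).
  rewrite /= -!IntN// -IntD; try exact: integrandN.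
  congr Int; apply/funext => y.
  rewrite rdot_osc; last by apply: symbZ_le (symbW _ (sGe' e)).
  rewrite addrK DG oscD; try by apply: symb_integrand; apply: symbZ_le sga.
    by rewrite mulrN opprK mulrDr addrA addNr add0r.
  by apply: symb_integrand; apply: symbZ_le sgb.
have XA j : (j <= m)%N -> kernel_bounded (X j).
  by elim: j => [//|j IH] jm; apply: XS => //; apply: IH; exact: ltnW.
(* D^m c is the constant m! c(v), so dividing by m! recovers the wanted functional. *)
have mf0 : m`!%:R != 0 :> R by rewrite pnatr_eq0 -lt0n fact_gt0.
have := kernel_boundedZ m`!%:R^-1 (XA m (leqnn m)).
move=> /kernel_bounded_ext; apply => u x l l0 tu.
rewrite /X mulr_sumr; apply: eq_bigr => e _; rewrite subnn.
have ih : symb 0 (- (2 * n).+1%:Z) h.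
  apply: (@symbZ_le _ _ _ (2 * n + k.+1 + m)).
    by rewrite addnS addSn ltnS -addnA leq_addr.
  exact: symbW sh.
have -> : (fun xi => iterD v m (c e) xi * iterD v 0 h xi) =
    fun xi => (m`!%:R * c e v) * h xi.
  by apply/funext => xi; rewrite cm.
transitivity (m`!%:R^-1 * Int (fun y => (m`!%:R * c e v) *
    (system u e y * osc h th (l *: (y - x))))).
  rewrite IntZ; last by apply: integrand_system => //; exact: continuous_osc_affine.
  by rewrite -mulrA mulKf.
congr (_ * Int _); apply/funext => y; rewrite oscZ 1?mulrCA//.
by apply: symb_integrand; apply: symbZ_le ih.
Qed.

End cancellation.

(** * Homogeneous polynomials and elliptic symbols *)

Section homogeneous_polynomials.
Context {R : realType} {n : nat}.
Implicit Types (f g : 'rV[R]_n -> R) (x v : 'rV[R]_n).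

Inductive hpoly : nat -> ('rV[R]_n -> R) -> Prop :=
| hpoly_cst c : hpoly 0 (fun=> c)
| hpoly_coord i : hpoly 1 (fun x => x 0 i)
| hpoly0 d : hpoly d (fun=> 0)
| hpolyD d f g : hpoly d f -> hpoly d g -> hpoly d (fun x => f x + g x)
| hpolyM d d' f g : hpoly d f -> hpoly d' g -> hpoly (d + d') (fun x => f x * g x).

Lemma hpolyZ d c f : hpoly d f -> hpoly d (fun x => c * f x).
Proof. by move=> hf; rewrite -[d]add0n; apply: hpolyM => //; exact: hpoly_cst. Qed.

Lemma hpolyN d f : hpoly d f -> hpoly d (fun x => - f x).
Proof.
move=> /(hpolyZ (-1)); rewrite (_ : (fun x => -1 * f x) = fun x => - f x)//.
by apply/funext => x; rewrite mulN1r.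
Qed.

Lemma hpoly_sum d I (s : seq I) (P : pred I) (f : I -> 'rV[R]_n -> R) :
  (forall i, hpoly d (f i)) -> hpoly d (fun x => \sum_(i <- s | P i) f i x).
Proof.
move=> hf; elim: s => [|a s IH].
  rewrite (_ : (fun _ => _) = fun=> 0); first exact: hpoly0.
  by apply/funext => x; rewrite big_nil.
rewrite (_ : (fun _ => _) = fun x =>
    (if P a then f a x else 0) + \sum_(i <- s | P i) f i x).
  by apply: hpolyD => //; case: (P a) => //; exact: hpoly0.
by apply/funext => x; rewrite big_cons; case: (P a); rewrite ?add0r.
Qed.

Lemma hpoly_prod d I (s : seq I) (f : I -> 'rV[R]_n -> R) :
  (forall i, hpoly d (f i)) -> hpoly (size s * d) (fun x => \prod_(i <- s) f i x).
Proof.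
move=> hf; elim: s => [|a s IH].
  rewrite (_ : (fun _ => _) = fun=> 1); first exact: hpoly_cst.
  by apply/funext => x; rewrite big_nil.
rewrite (_ : (fun _ => _) = fun x => f a x * \prod_(i <- s) f i x).
  exact: hpolyM.
by apply/funext => x; rewrite big_cons.
Qed.

Lemma hpoly_mono s : hpoly (size s) (@mono R n s).
Proof.
rewrite -[size s]muln1; apply: (@hpoly_prod 1 _ s (fun i x => x 0 i)) => i.
exact: hpoly_coord.
Qed.

Lemma symb_hpoly d f M : hpoly d f -> symb M d%:Z f.
Proof.
move=> hf; elim: hf M => {d f} [c|i|d|d f g _ IHf _ IHg|d d' f g _ IHf _ IHg] M.
- exact: symb_cst.
- exact: symb_coord.
- by apply: (@symb_le _ _ _ 0) => //; exact: symb_cst.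
- exact: symbD.
- by rewrite PoszD; exact: symbM.
Qed.

Lemma hpoly_homogeneous d f c x : hpoly d f -> f (c *: x) = c ^+ d * f x.
Proof.
elim=> {d f} [a|i|d|d f g _ IHf _ IHg|d d' f g _ IHf _ IHg].
- by rewrite expr0 mul1r.
- by rewrite mxE expr1.
- by rewrite mulr0.
- by rewrite IHf IHg mulrDr.
- by rewrite IHf IHg exprD mulrACA.
Qed.

Lemma coefM_top (p q : {poly R}) d d' :
  (size p <= d.+1)%N -> (size q <= d'.+1)%N -> (p * q)`_(d + d') = p`_d * q`_d'.
Proof.
move=> sp sq.
have dlt : (d < (d + d').+1)%N by rewrite ltnS leq_addr.
rewrite coefM (bigD1 (Ordinal dlt))//= big1 ?addr0 ?addKn// => j jd.
have [dj|jd'] := ltnP d j.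
  by rewrite nth_default ?mul0r// (leq_trans sp).
rewrite [X in _ * X]nth_default ?mulr0// (leq_trans sq)//.
have {}jd' : (j < d)%N by rewrite ltn_neqAle jd' andbT; apply: contra jd => /eqP jd; apply/eqP/val_inj.
lia.
Qed.

(** The coefficient of s^d does not see the base point [x]: it is the value at the direction. This
    is why differentiating d times evaluates [f] at [v]. *)
Lemma hpoly_line d f x v : hpoly d f ->
  exists2 p : {poly R}, (size p <= d.+1)%N /\ p`_d = f v &
    forall s, f (s *: v + x) = p.[s].
Proof.
elim=> {d f} [c|i|d|d f g _ [p [sp pd] pE] _ [q [sq qd] qE]|
  d d' f g _ [p [sp pd] pE] _ [q [sq qd] qE]].
- by exists c%:P => [|s]; rewrite ?hornerC// coefC size_polyC; case: (c != 0).
- exists (v 0 i *: 'X + (x 0 i)%:P) => [|s]; last by rewrite !hornerE !mxE mulrC.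
  split; last by rewrite coefD coefZ coefX coefC mulr1 addr0.
  rewrite (leq_trans (size_polyD _ _))// geq_max (leq_trans (size_scale_leq _ _)) ?size_polyX//.
  by rewrite size_polyC; case: (_ != _).
- by exists 0 => [|s]; rewrite ?horner0// size_poly0 coef0.
- exists (p + q) => [|s]; last by rewrite hornerD pE qE.
  by rewrite coefD pd qd (leq_trans (size_polyD _ _))// geq_max sp.
- exists (p * q) => [|s]; last by rewrite hornerM pE qE.
  rewrite coefM_top// pd qd; split => //.
  by rewrite (leq_trans (size_polyMleq _ _))//; lia.
Qed.

Lemma hpoly_iterD d f v x : hpoly d f -> iterD v d f x = d`!%:R * f v.
Proof.
move=> hf; have [p [sp pd] pE] := hpoly_line x v hf.
(* Iterated derivatives along [v] become ordinary derivatives of the one-variable polynomial [p]. *)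
have E j : forall s, iterD v j f (s *: v + x) = p^`(j).[s].
  elim: j => [|j IH] s; first by rewrite derivn0 -pE.
  have D : is_derive (s *: v + x) v (iterD v j f) (iterD v j.+1 f (s *: v + x)).
    apply: DeriveDef => //; apply: (@symb_derivable _ _ 0 d%:Z).
    by apply: symb_iterD; exact: symb_hpoly.
  have D1 := is_derive_line D.
  rewrite (_ : (fun _ => _) = fun s => p^`(j).[s]) in D1; last exact/funext.
  have D2 := is_derive_poly p^`(j) s.
  rewrite -(@derive_val _ _ _ _ _ _ _ D1) (@derive_val _ _ _ _ _ _ _ D2).
  by rewrite derivnS.
have := E d 0; rewrite scale0r add0r => ->.
by rewrite horner_coef0 coef_derivn addn0 ffactnn pd mulr_natl.
Qed.

Lemma hpoly_det d m (A : 'rV[R]_n -> 'M[R]_m) :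
  (forall i j, hpoly d (fun x => A x i j)) -> hpoly (m * d) (fun x => \det (A x)).
Proof.
move=> hA.
rewrite /determinant; apply: hpoly_sum => s.
apply: hpolyZ; rewrite -[m in (m * d)%N]card_ord cardT enumT.
exact: hpoly_prod.
Qed.

Lemma hpoly_adj d m (A : 'rV[R]_n -> 'M[R]_m) i j :
  (forall i j, hpoly d (fun x => A x i j)) ->
  hpoly (m.-1 * d) (fun x => (\adj (A x)) i j).
Proof.
move=> hA.
rewrite (_ : (fun _ => _) = fun x => (-1) ^+ (j + i) * \det (row' j (col' i (A x)))).
  apply: hpolyZ; apply: hpoly_det => a b.
  rewrite (_ : (fun _ => _) = fun x => A x (lift j a) (lift i b))//.
  by apply/funext => x; rewrite !mxE.
by apply/funext => x; rewrite mxE.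
Qed.

Lemma hpoly_mulmx d d' m1 m2 m3 (A : 'rV[R]_n -> 'M[R]_(m1, m2))
    (B : 'rV[R]_n -> 'M[R]_(m2, m3)) i j :
  (forall i j, hpoly d (fun x => A x i j)) ->
  (forall i j, hpoly d' (fun x => B x i j)) ->
  hpoly (d + d') (fun x => (A x *m B x) i j).
Proof.
move=> hA hB.
rewrite (_ : (fun _ => _) = fun x => \sum_l A x i l * B x l j).
  by apply: hpoly_sum => l; exact: hpolyM.
by apply/funext => x; rewrite mxE.
Qed.

End homogeneous_polynomials.

(** A subspace contained in no hyperplane is everything. As [S] is a mere predicate, a row space of
    maximal rank inside [S] is chosen; if it were not full, a vector [e] orthogonal to it and some
    [c] in [S] with c e^T <> 0 would enlarge it. *)
Lemma subspace_full (F : fieldType) q (S : 'rV[F]_q -> Prop) :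
  S 0 -> (forall c d, S c -> S d -> S (c + d)) ->
  (forall a c, S c -> S (a *: c)) ->
  (forall e : 'rV[F]_q, e != 0 -> exists c, S c /\ c *m e^T != 0) ->
  forall c, S c.
Proof.
move=> S0 SD SZ Se.
pose span (r : nat) := `[< exists B : 'M[F]_q, \rank B = r /\
  forall v : 'rV[F]_q, (v <= B)%MS -> S v >].
have ex0 : exists r, span r.
  by exists 0%N; apply/asboolP; exists 0; split => [|v]; rewrite ?mxrank0// submx0 => /eqP ->.
have ub r : span r -> (r <= q)%N.
  by move=> /asboolP[B [<- _]]; exact: rank_leq_row.
have [r /asboolP[B [rB SB]] rmax] := ex_maxnP ex0 ub.
have [rq|rq] := ltnP r q; last first.
  by move=> c; apply: SB; apply: submx_full; rewrite -col_leq_rank rB.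
have : (kermx B^T)^T^T != 0.
  by rewrite trmxK -mxrank_eq0 mxrank_ker mxrank_tr rB -lt0n subn_gt0.
rewrite trmxK => /rowV0Pn[e eB e0].
have [c [Sc ce]] := Se e e0.
have Be : B *m e^T = 0.
  by move/sub_kermxP : eB => /(congr1 trmx); rewrite trmx_mul trmxK trmx0.
have cB : ~~ (c <= B)%MS.
  by apply: contra ce => /submxP[D ->]; rewrite -mulmxA Be mulmx0.
have lt : (r < \rank (B + c)%MS)%N.
  rewrite -rB ltnNge; apply: contra cB => rk.
  have /eqmxP BBc : (B == B + c)%MS by rewrite -mxrank_leqif_eq ?addsmxSl// eqn_leq rk andbT mxrankS// addsmxSl.
  by rewrite BBc addsmxSr.
suff /rmax : span (\rank (B + c)%MS) by rewrite leqNgt lt.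
apply/asboolP; exists (B + c)%MS; split => // v /sub_addsmxP[[u1 u2] /= ->].
apply: SD; first by apply: SB; exact: submxMl.
by rewrite [u2]mx11_scalar mul_scalar_mx; exact: SZ.
Qed.

Lemma mulmx_trmx_eq0 {R : realType} q (w : 'rV[R]_q) : w *m w^T = 0 -> w = 0.
Proof.
move=> /matrixP/(_ 0 0); rewrite !mxE => /eqP.
rewrite psumr_eq0 => [/allP w0|j _]; last by rewrite mxE -expr2 sqr_ge0.
apply/rowP => j; have := w0 j (mem_index_enum _).
by rewrite mxE mulf_eq0 orbb => /eqP ->; rewrite mxE.
Qed.

Lemma min_on_sphere {R : realType} n (f : 'rV[R]_n -> R) : (0 < n)%N -> continuous f ->
  exists2 c, `|c| = 1 & forall xi, `|xi| = 1 -> f c <= f xi.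
Proof.
move=> n0 cf; pose S : set 'rV[R]_n := [set xi | `|xi| = 1].
have cS : compact S.
  apply: bounded_closed_compact.
    exists 1; split; first exact: num_real.
    by move=> M M1 x; rewrite /S/= => ->; exact: ltW.
  rewrite (_ : S = (fun x => `|x|) @^-1` [set 1])//.
  by apply: closed_comp => [x _|]; [exact: norm_continuous|exact: closed_eq].
have S0 : S !=set0.
  pose v : 'rV[R]_n := const_mx 1.
  have v0 : `|v| != 0.
    rewrite normr_eq0; apply/eqP => /rowP/(_ (Ordinal n0)); rewrite !mxE => /eqP.
    by rewrite oner_eq0.
  by exists (`|v|^-1 *: v); rewrite /S/= normrZ ger0_norm ?invr_ge0// mulVf.
have [c Sc cmin] := EVT_min_rV S0 cS (continuous_subspaceT cf).
by exists c; [rewrite inE in Sc|move=> xi xi1; apply: cmin; rewrite inE].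
Qed.

Section elliptic_symbol.
Context {R : realType} {n : nat}.
Variables (p q k : nat) (P : 'rV[R]_n -> 'M[R]_(p, q)).
Hypothesis p_gt0 : (0 < p)%N.
Hypothesis hP : forall i j, hpoly k (fun xi => P xi i j).
Hypothesis P_free : forall xi, xi != 0 -> row_free (P xi).
Implicit Types xi : 'rV[R]_n.

Definition gram xi := P xi *m (P xi)^T.
Definition detG xi := \det (gram xi).
(** Squaring the determinant makes nonnegativity immediate. *)
Definition bsym xi := detG xi * detG xi.
(** Off 0 this is [bsym] times the pseudo-inverse P^T (P P^T)^(-1), cleared of denominators. It
    multiplies [P] on the right because vectors are rows. *)
Definition left_inv xi : 'M[R]_(q, p) := detG xi *: ((P xi)^T *m \adj (gram xi)).
(** Off 0 this is [bsym] times the orthogonal projection onto the complement of the row space of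
    [P xi]. *)
Definition annihilator xi : 'M[R]_q := (bsym xi)%:M - left_inv xi *m P xi.
Definition bdeg := (p * (k + k) + p * (k + k))%N.

Lemma mul_left_inv xi : P xi *m left_inv xi = (bsym xi)%:M.
Proof. by rewrite -scalemxAr mulmxA mul_mx_adj scale_scalar_mx. Qed.

Lemma mul_annihilator xi : P xi *m annihilator xi = 0.
Proof.
by rewrite mulmxBr mulmxA mul_left_inv -scalar_mxC subrr.
Qed.

Lemma bsym_ge0 xi : 0 <= bsym xi.
Proof. by rewrite /bsym -expr2 sqr_ge0. Qed.

(** If v P P^T = 0 then (v P)(v P)^T = 0, so v P = 0, and v = 0 because the rows of [P xi] are
    free. *)
Lemma detG_neq0 xi : xi != 0 -> detG xi != 0.
Proof.
move=> xi0; rewrite -unitfE -[_ \is a _]/(gram xi \in unitmx) -row_free_unit.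
apply/inj_row_free => v; rewrite mulmxA => vG.
have vP : v *m P xi = 0.
  by apply: mulmx_trmx_eq0; rewrite trmx_mul mulmxA vG mul0mx.
by have := P_free xi0 => /row_free_inj/(_ v 0); rewrite vP mul0mx; exact.
Qed.

Lemma bsym_gt0 xi : xi != 0 -> 0 < bsym xi.
Proof. by move=> /detG_neq0 d0; rewrite /bsym -expr2 exprn_even_gt0. Qed.

Lemma annihilator_submx (e : 'rV[R]_q) xi : xi != 0 ->
  e *m annihilator xi = 0 -> (e <= P xi)%MS.
Proof.
move=> /bsym_gt0 b0; rewrite mulmxBr scalar_mxC mul_scalar_mx => /eqP.
rewrite subr_eq0 => /eqP eE.
have -> : e = ((bsym xi)^-1 *: (e *m left_inv xi)) *m P xi.
  by rewrite -scalemxAl -mulmxA -eE scalerA mulVf ?scale1r// gt_eqF.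
exact: submxMl.
Qed.

Lemma hpoly_gram i j : hpoly (k + k) (fun xi => gram xi i j).
Proof.
apply: hpoly_mulmx => // a b; rewrite (_ : (fun _ => _) = fun xi => P xi b a)//.
by apply/funext => xi; rewrite mxE.
Qed.

Lemma hpoly_detG : hpoly (p * (k + k)) detG.
Proof. exact: hpoly_det hpoly_gram. Qed.

Lemma hpoly_bsym : hpoly bdeg bsym.
Proof. exact: hpolyM hpoly_detG hpoly_detG. Qed.

Lemma hpoly_left_inv i j :
  hpoly (p * (k + k) + (k + p.-1 * (k + k))) (fun xi => left_inv xi i j).
Proof.
rewrite (_ : (fun _ => _) = fun xi => detG xi * ((P xi)^T *m \adj (gram xi)) i j).
  apply: hpolyM; first exact: hpoly_detG.
  apply: hpoly_mulmx => a b; last by apply: hpoly_adj; exact: hpoly_gram.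
  rewrite (_ : (fun _ => _) = fun xi => P xi b a)//.
  by apply/funext => xi; rewrite mxE.
by apply/funext => xi; rewrite mxE.
Qed.

Lemma hpoly_annihilator i j : hpoly bdeg (fun xi => annihilator xi i j).
Proof.
rewrite (_ : (fun _ => _) = fun xi => (i == j)%:R * bsym xi +
    (- (left_inv xi *m P xi) i j)).
  apply: hpolyD; first by apply: hpolyZ; exact: hpoly_bsym.
  apply: hpolyN.
  (* Writing p = (p - 1) + 1 shows that [left_inv] has degree [bdeg] - k, so the product with [P]
     has degree [bdeg] too. *)
  rewrite (_ : bdeg = p * (k + k) + (k + p.-1 * (k + k)) + k)%N; last first.
    by rewrite /bdeg -{2}(prednK p_gt0) mulSn; lia.
  by apply: hpoly_mulmx => // a b; exact: hpoly_left_inv.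
by apply/funext => xi; rewrite !mxE mulr_natl.
Qed.

Lemma bdeg_gt0 : (0 < k)%N -> (0 < bdeg)%N.
Proof. by move=> k0; rewrite /bdeg addn_gt0 muln_gt0 p_gt0 addn_gt0 k0. Qed.

(** [c] is the minimum of [bsym] on the unit sphere, extended by homogeneity. At 0 the inequality
    holds because [bdeg] is positive. *)
Lemma bsym_lower_bound : (0 < n)%N -> (0 < k)%N ->
  exists2 c, 0 < c & forall xi, c * `|xi| ^+ bdeg <= bsym xi.
Proof.
move=> n0 k0.
have cb : continuous bsym := symb_continuous (symb_hpoly 0 hpoly_bsym).
have [c c1 cmin] := min_on_sphere n0 cb.
have c0 : c != 0 by rewrite -normr_eq0 c1 oner_eq0.
exists (bsym c); first exact: bsym_gt0.
move=> xi; have [->|x0] := eqVneq xi 0.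
  by rewrite normr0 expr0n gtn_eqF ?bdeg_gt0// mulr0 bsym_ge0.
rewrite -ler_pdivlMr ?exprn_gt0 ?normr_gt0// mulrC -exprVn.
rewrite -(hpoly_homogeneous _ _ hpoly_bsym); apply: cmin.
by rewrite normrZ ger0_norm ?invr_ge0// mulVf ?normr_eq0.
Qed.

End elliptic_symbol.

Section canceling_systems.
Context {R : realType} {n : nat}.
Variables (Idx : finType) (la : Idx -> seq 'I_n) (k p q : nat).
Variable Am : Idx -> 'M[R]_(p, q).
Hypothesis size_la : forall a, size (la a) = k.
Local Notation P := (system_symbol la Am).
Implicit Types (xi : 'rV[R]_n).

Lemma hpoly_system_symbol i j : hpoly k (fun xi => P xi i j).
Proof.
rewrite (_ : (fun _ => _) = fun xi => \sum_a Am a i j * mono (la a) xi).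
  by apply: hpoly_sum => a; apply: hpolyZ; rewrite -(size_la a); exact: hpoly_mono.
by apply/funext => xi; rewrite mxE.
Qed.

(** The covectors [c] whose functional is bounded form a subspace containing every column of
    [annihilator P xi] with xi <> 0. A vector orthogonal to all these columns lies in every row
    space, hence is 0 by cancellation; so the subspace is everything. *)
Lemma kernel_bounded_canceling h th e : (0 < p)%N ->
  (forall xi, xi != 0 -> row_free (P xi)) ->
  (forall e : 'rV[R]_q, (forall xi, xi != 0 -> (e <= P xi)%MS) -> e = 0) ->
  symb (bdeg p k + 2) (- (2 * n + k.+1 + bdeg p k)%:Z) h ->
  kernel_bounded la Am (fun u x l =>
    Int (fun y => system la Am u e y * osc h th (l *: (y - x)))).
Proof.
move=> p0 Pfree Pcancel sh.
pose S (c : 'rV[R]_q) := kernel_bounded la Am (fun u x l =>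
  \sum_e c 0 e * Int (fun y => system la Am u e y * osc h th (l *: (y - x)))).
suff : S (delta_mx 0 e).
  move=> /kernel_bounded_ext; apply => u x l _ _.
  rewrite (bigD1 e)//= big1 ?addr0 => [|j je]; rewrite mxE eqxx/= ?eqxx ?mul1r//.
  by rewrite (negbTE je) mul0r.
apply: subspace_full => [|c d Sc Sd|a c Sc|e' e0].
- apply: kernel_bounded_ext (kernel_bounded0 _ _) _ => u x l _ _.
  by rewrite big1// => j _; rewrite mxE mul0r.
- apply: kernel_bounded_ext (kernel_boundedD Sc Sd) _ => u x l _ _.
  by rewrite -big_split; apply: eq_bigr => j _; rewrite mxE mulrDl.
- apply: kernel_bounded_ext (kernel_boundedZ a Sc) _ => u x l _ _.
  by rewrite mulr_sumr; apply: eq_bigr => j _; rewrite mxE mulrA.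
have [xi xi0 exi] : exists2 xi, xi != 0 & e' *m annihilator P xi != 0.
  apply: contrapT => H; move/eqP: e0; apply; apply: Pcancel => xi xi0.
  apply: annihilator_submx => //; apply: contrapT => /eqP eA; apply: H.
  by exists xi.
have /rV0Pn[j ej] := exi.
exists (col j (annihilator P xi))^T; split.
  (* The direction of differentiation is [xi] itself, so that the moment identity returns the column
     at frequency [xi]. *)
  have K := @kernel_bounded_cancel _ _ _ la _ _ _ Am size_la
    (fun e xi => annihilator P xi e j) (bdeg p k) xi h th _ _ _ sh.
  apply: kernel_bounded_ext (K _ _ _) _ => [e1 M|xi1 i|e1 xi1|u x l _ _].
  - exact: symb_hpoly (hpoly_annihilator p0 hpoly_system_symbol e1 j).
  - have /matrixP/(_ i j) := mul_annihilator P xi1; rewrite !mxE => PA.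
    by rewrite -[RHS]PA; apply: eq_bigr => e1 _; rewrite mxE.
  - exact: hpoly_iterD (hpoly_annihilator p0 hpoly_system_symbol e1 j).
  - by apply: eq_bigr => e1 _; rewrite !mxE.
rewrite -trmx_mul; apply: contra ej => /eqP/matrixP/(_ 0 0).
rewrite !mxE => ej; rewrite -[X in _ == X]ej; apply/eqP/eq_bigr => i _.
by rewrite [in RHS]mxE.
Qed.

End canceling_systems.

(** * Low-pass kernels *)

Section low_pass.
Context {R : realType} {n : nat}.
Variables (b : 'rV[R]_n -> R) (d N : nat).
Hypothesis b_ge0 : forall xi, 0 <= b xi.
Hypothesis hb : hpoly d b.
Hypothesis b_lower : exists2 c, 0 < c & forall xi, c * `|xi| ^+ d <= b xi.
Local Hint Resolve oneDnorm_gt0 : core.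

Lemma symb_resolvent (s : R) M : 0 < s ->
  symb M (- d%:Z) (fun xi => (1 + s * b xi)^-1).
Proof.
move=> s0.
have pos xi : 0 < 1 + s * b xi by rewrite ltr_pwDl// mulr_ge0// ltW.
apply: symb_inv => // [M'|].
  apply: symbD; first by apply: (@symb_le _ _ _ 0) => //; exact: symb_cst.
  by apply: symbZ; exact: symb_hpoly.
have [c c0 cb] := b_lower.
(* 2^d comes from (1 + |xi|)^d <= 2^d (1 + |xi|^d), and 1 + 1 / (s c) from c |xi|^d <= b. *)
exists (2 ^+ d * (1 + (s * c)^-1)) => xi.
have sc0 : 0 < s * c by exact: mulr_gt0.
apply: (@le_trans _ _ (2 ^+ d * (1 + `|xi| ^+ d))).
  have [x1|x1] := leP `|xi| 1.
    apply: (@le_trans _ _ (2 ^+ d)); last by rewrite ler_peMr ?exprn_ge0// lerDl exprn_ge0.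
    by rewrite lerXn2r ?nnegrE ?addr_ge0//; lra.
  apply: (@le_trans _ _ ((2 * `|xi|) ^+ d)).
    by rewrite lerXn2r ?nnegrE ?addr_ge0 ?mulr_ge0//; lra.
  by rewrite exprMn ler_wpM2l ?exprn_ge0// lerDr.
rewrite -mulrA ler_wpM2l ?exprn_ge0// mulrDl mul1r lerD//.
  by rewrite lerDl mulr_ge0// ltW.
rewrite mulrDr mulr1 ler_wpDl ?invr_ge0 ?(ltW sc0)//.
rewrite invfM -mulrA mulrCA mulKf ?gt_eqF// ler_pdivlMl//.
Qed.

Definition low_pass (s : R) xi : R := (1 + s * b xi)^-1 ^+ N.

(** With a = (1 + b)^(-1) and a' = (1 + 2^d b)^(-1), this is the quotient of a^N - a'^N by b: the
    factor a - a' equals (2^d - 1) b a a', and the extra a a' shifts the exponents to N - i and i +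
    1. *)
Definition band xi : R := (2 ^+ d - 1) *
  \sum_(i < N) (1 + b xi)^-1 ^+ (N - i) * (1 + 2 ^+ d * b xi)^-1 ^+ i.+1.

Lemma symb_exp M o f m : symb M o f -> symb M (o * m%:Z) (fun xi : 'rV[R]_n => f xi ^+ m).
Proof.
move=> sf; elim: m => [|m IH].
  rewrite mulr0 (_ : (fun _ => _) = fun=> 1); first exact: symb_cst.
  by apply/funext => xi; rewrite expr0.
rewrite (_ : (fun _ => _) = fun xi => f xi * f xi ^+ m).
  by rewrite -add1n PoszD mulrDr mulr1; exact: symbM.
by apply/funext => xi; rewrite exprS.
Qed.

Lemma symb_low_pass (s : R) M : 0 < s -> symb M (- (d * N)%:Z) (low_pass s).
Proof.
by move=> s0; rewrite PoszM -mulNr; apply: symb_exp; exact: symb_resolvent.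
Qed.

Lemma symb_band M : symb M (- (d * N.+1)%:Z) band.
Proof.
apply: symbZ; apply: symb_sum => i.
(* Every summand carries (N - i) + (i + 1) = N + 1 resolvents. *)
rewrite (_ : - (d * N.+1)%:Z = - d%:Z * (N - i)%:Z + - d%:Z * i.+1%:Z); last first.
  by rewrite -mulrDr -PoszD addnS subnK 1?ltnW// PoszM mulNr.
apply: symbM; apply: symb_exp; last exact: symb_resolvent.
by have := @symb_resolvent 1 M ltr01; under eq_fun do rewrite mul1r.
Qed.

(* b cancels against the denominator of the left inverse of the symbol. *)
Lemma low_pass_band xi : low_pass 1 xi - low_pass 1 (2 *: xi) = b xi * band xi.
Proof.
rewrite /low_pass /band (hpoly_homogeneous _ _ hb) !mul1r subrXX.
have p1 : 1 + b xi != 0 by rewrite gt_eqF// ltr_pwDl.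
have p2 : 1 + 2 ^+ d * b xi != 0 by rewrite gt_eqF// ltr_pwDl// mulr_ge0// exprn_ge0.
have -> : (1 + b xi)^-1 - (1 + 2 ^+ d * b xi)^-1 =
    (2 ^+ d - 1) * b xi * ((1 + b xi)^-1 * (1 + 2 ^+ d * b xi)^-1).
  by field; rewrite p1 p2.
rewrite -!mulrA mulrCA; congr (_ * (_ * _)).
rewrite !mulr_sumr; apply: eq_bigr => i _.
have -> : (N - i = (N.-1 - i).+1)%N by have := ltn_ord i; lia.
by rewrite !exprS; ring.
Qed.

End low_pass.

(** * Dominated convergence, Fubini for the cosine transform, approximate identities *)

Section approximate_identity.
Context {R : realType}.
Local Notation RT := (measurableTypeR R).
Local Notation mu n := (@lebesgue_measure_tuple R n).
Local Hint Resolve oneDnorm_gt0 : core.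

Lemma Int_cvg n (f_ : nat -> 'rV[R]_n -> R) (f g : 'rV[R]_n -> R) :
  (forall j, integrand (f_ j)) -> integrand f -> integrand g ->
  (forall j x, `|f_ j x| <= g x) -> (forall x, f_ j x @[j --> \oo] --> f x) ->
  Int (f_ j) @[j --> \oo] --> Int f.
Proof.
move=> if_ iF ig fg ff.
have fE (t : n.-tuple RT) :
    (f_ j (row_of t))%:E @[j --> \oo] --> (f (row_of t))%:E.
  by apply/fine_cvgP; split; [exact: nearW|exact: ff].
have [_ _ H] := dominated_convergence (mu := mu n) measurableT
  (fun j => measurable_int _ (integrand_integrable (if_ j)))
  (measurable_int _ (integrand_integrable iF))
  (aeW _ (fun t _ => fE t)) (integrand_integrable ig)
  (aeW _ (fun t j _ => (fg j (row_of t) : (`|(f_ j (row_of t))%:E| <= (g (row_of t))%:E)%E))).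
apply: fine_cvg; move: H; rewrite [X in _ --> X](_ : _ = (Int f)%:E)//.
by rewrite -integral_Rn_Int.
Qed.

(** A zero integral would make [f] vanish almost everywhere, so the whole space would be null,
    contradicting that the product weight has integral pi^n. *)
Lemma Int_gt0 n (f : 'rV[R]_n -> R) : integrand f -> (forall x, 0 < f x) -> 0 < Int f.
Proof.
move=> iF f0; rewrite lt_neqAle Int_ge0 => [|x]; last exact: ltW.
rewrite andbT; apply/eqP => I0.
have mf := measurable_int _ (integrand_integrable iF).
have : (\int[mu n]_t `|(f (row_of t))%:E| = 0)%E.
  transitivity (Int f)%:E; last by rewrite -I0.
  rewrite -integral_Rn_Int//; apply: eq_integral => t _.
  by rewrite gee0_abs// lee_fin ltW.
move=> /(ae_eq_integral_abs (mu n) measurableT mf)[A [mA A0 sA]].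
have {}sA : A = setT.
  apply/seteqP; split => // t _; apply: sA => /= /(_ I) /eqP.
  by rewrite eqe gt_eqF.
rewrite sA in A0.
have := @integral_prod_oneDsqrV R n.
rewrite (null_set_integral measurableT (@measurable_prod_oneDsqrV R n) A0).
by move=> [] /esym/eqP; rewrite expf_eq0 gt_eqF ?pi_gt0// andbF.
Qed.

Lemma measurable_rdot_pair n :
  measurable_fun [set: n.-tuple RT * n.-tuple RT]
    (fun s => rdot (row_of s.1) (row_of s.2)).
Proof.
rewrite (_ : (fun _ => _) = fun s : n.-tuple RT * n.-tuple RT =>
    \sum_i tnth s.1 i * tnth s.2 i); last first.
  by apply/funext => s; apply: eq_bigr => i _; rewrite !mxE.
apply: (@measurable_sum _ _ _ _ _ _ (fun i (s : n.-tuple RT * n.-tuple RT) => tnth s.1 i * tnth s.2 i)) => i.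
apply: measurable_funM.
  by apply: (@measurableT_comp _ _ _ _ _ _ (fun t : n.-tuple RT => tnth t i)); [exact: measurable_tnth|exact: measurable_fst].
by apply: (@measurableT_comp _ _ _ _ _ _ (fun t : n.-tuple RT => tnth t i)); [exact: measurable_tnth|exact: measurable_snd].
Qed.

(** The multiplication formula for Fourier transforms: at phase 0 the cosine kernel is symmetric,
    and Fubini applies because |g| |h| dominates the double integrand. *)
Lemma Int_osc_swap n (h g : 'rV[R]_n -> R) : integrand h -> integrand g ->
  Int (fun z => osc h 0 z * g z) = Int (fun xi => h xi * osc g 0 xi).
Proof.
move=> ih ig.
pose f (s : n.-tuple RT * n.-tuple RT) : \bar R :=
  (h (row_of s.2) * cos (rdot (row_of s.1) (row_of s.2) + 0) * g (row_of s.1))%:E.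
have mf : measurable_fun setT f.
  apply/measurable_EFinP; apply: measurable_funM; first apply: measurable_funM.
  - apply: (@measurableT_comp _ _ _ _ _ _ (fun t : n.-tuple RT => h (row_of t))).
      by apply: measurable_continuous_row; case: ih.
    exact: measurable_snd.
  - apply: (@measurableT_comp _ _ _ _ _ _ (@cos R)).
      by apply: continuous_measurable_fun; exact: continuous_cos.
    by apply: measurable_funD => //; exact: measurable_rdot_pair.
  - apply: (@measurableT_comp _ _ _ _ _ _ (fun t : n.-tuple RT => g (row_of t))).
      by apply: measurable_continuous_row; case: ig.
    exact: measurable_fst.
have iF : (mu n \x mu n)%E.-integrable setT f.
  apply/integrable12ltyP => //.
  apply: (@le_lt_trans _ _ (\int[mu n]_t (`|g (row_of t)| * Int (fun xi => `|h xi|))%:E)%E).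
    apply: ge0_le_integral => //.
    - by move=> t _; exact: integral_ge0.
    - apply: (@measurable_fun_fubini_tonelli_F _ _ _ _ _ (mu n) (abse \o f)).
        exact: measurableT_comp.
      by move=> s; exact: abse_ge0.
    - apply/measurable_EFinP; apply: measurable_funM => //.
      by apply: measurableT_comp => //; apply: measurable_continuous_row; case: ig.
    - move=> t _; rewrite EFinM.
      rewrite -(@integral_Rn_Int _ _ (fun xi => `|h xi|)); last exact: integrand_norm.
      rewrite /integral_Rn -ge0_integralZl//; last first.
        by apply/measurable_EFinP/measurableT_comp => //; apply: measurable_continuous_row; case: ih.
      apply: ge0_le_integral => //.
      + apply: measurableT_comp => //.
        apply: (measurableT_comp mf).
        by apply: measurable_fun_pair => //.
      + apply: measurable_funeM; apply/measurable_EFinP/measurableT_comp => //.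
        by apply: measurable_continuous_row; case: ih.
      + move=> s _; rewrite /f/= lee_fin !normrM [leRHS]mulrC ler_wpM2r//.
        by rewrite ler_piMr// normr_cos_le1.
  rewrite (_ : (\int[mu n]_t _)%E = (Int (fun z => Int (fun xi => `|h xi|) * `|g z|))%:E) ?ltry//.
  rewrite -integral_Rn_Int; last by apply: integrandZ; exact: integrand_norm.
  by apply: eq_integral => t _; rewrite mulrC.
have := Fubini iF; rewrite /= /f => FE.
congr fine.
transitivity (\int[mu n]_x \int[mu n]_y (h (row_of y) * cos (rdot (row_of x) (row_of y) + 0) * g (row_of x))%:E)%E.
  apply: eq_integral => t _.
  have ic : integrand (fun xi => g (row_of t) * (h xi * cos (rdot (row_of t) xi + 0))).
    by apply: integrandZ; exact: integrand_cos.
  rewrite /osc mulrC -IntZ; last exact: integrand_cos.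
  rewrite -integral_Rn_Int//; apply: eq_integral => s _.
  by rewrite mulrC.
rewrite FE; apply: eq_integral => s _.
rewrite /osc -IntZ; last exact: integrand_cos.
rewrite -integral_Rn_Int; last by apply: integrandZ; exact: integrand_cos.
apply: eq_integral => t _; congr EFin.
by rewrite -mulrA (rdotC (row_of t)) [in LHS](mulrC (cos _)).
Qed.

Lemma osc_scale n (h : 'rV[R]_n -> R) (s : R) th z : 0 < s -> integrand h ->
  osc h th (s^-1 *: z) = s ^+ n * osc (fun xi => h (s *: xi)) th z.
Proof.
move=> s0 ih; rewrite /osc (Int_affine 0 s0); last exact: integrand_cos.
congr (_ * Int _); apply/funext => xi; rewrite add0r; congr (_ * cos (_ + _)).
by rewrite rdotZl rdotZr mulKf// gt_eqF.
Qed.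

Lemma Int_kernel_affine n (w f : 'rV[R]_n -> R) x (l : R) : 0 < l -> continuous w ->
  (exists C, forall y, `|w y| <= C) -> integrand f ->
  l ^+ n * Int (fun y => w y * f (l *: (y - x))) =
  Int (fun z => w (x + l^-1 *: z) * f z).
Proof.
move=> l0 cw bw iF.
have iwf : integrand (fun y => w y * f (l *: (y - x))).
  apply: integrandMb => //.
  have := integrand_affine (- (l *: x)) l0 iF.
  rewrite (_ : (fun y => f (- (l *: x) + l *: y)) = fun y => f (l *: (y - x)))//.
  by apply/funext => y; rewrite scalerBr addrC.
have li0 : 0 < l^-1 by rewrite invr_gt0.
rewrite (Int_affine x li0 iwf) mulrA -exprMn divff ?gt_eqF// expr1n mul1r.
congr Int; apply/funext => z; congr (_ * f _).
by rewrite addrC addKr scalerA divff ?scale1r// gt_eqF.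
Qed.

(** After substitution the kernel is fixed and [w] is evaluated at x + z / l, which tends to [x]; C
    |f| dominates. *)
Lemma approximate_identity n (w f : 'rV[R]_n -> R) x (l : nat -> R) :
  (forall j, 0 < l j) -> (l j)^-1 @[j --> \oo] --> 0 ->
  continuous w -> (exists C, forall y, `|w y| <= C) -> integrand f ->
  (l j) ^+ n * Int (fun y => w y * f (l j *: (y - x))) @[j --> \oo] -->
    w x * Int f.
Proof.
move=> l0 l_cvg cw [C wC] iF.
rewrite (_ : (fun j => _) = fun j => Int (fun z => w (x + (l j)^-1 *: z) * f z)); last first.
  by apply/funext => j; rewrite Int_kernel_affine//; exists C.
rewrite -IntZ//.
have cwj j : continuous (fun z : 'rV[R]_n => w (x + (l j)^-1 *: z)).
  apply: (@continuous_compose _ _ _ (fun z : 'rV[R]_n => x + (l j)^-1 *: z) w) => //.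
  by apply: continuous_add; [exact: cst_continuous|exact: scaler_continuous].
apply: (@Int_cvg _ _ _ (fun z => C * `|f z|)).
- by move=> j; apply: integrandMb => //; exists C.
- exact: integrandZ.
- by apply: integrandZ; exact: integrand_norm.
- by move=> j z; rewrite normrM ler_wpM2r.
- move=> z; apply: (@cvgMl _ _ _ eventually_filter).
  apply: (@cvg_comp _ _ _ (fun j => x + (l j)^-1 *: z) w _ (nbhs x)); last exact: cw.
  have : (fun j => x + (l j)^-1 *: z) @ \oo --> x + 0 *: z.
    by apply: (@cvgD _ _ _ \oo); [exact: cvg_cst|exact: cvgZr_tmp].
  by rewrite scale0r addr0.
Qed.

End approximate_identity.

(** * The Gaussian and its cosine transform *)

Section gaussian.
Context {R : realType} {n : nat}.
Implicit Types (xi z v : 'rV[R]_n).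
Local Hint Resolve oneDnorm_gt0 : core.

Lemma rdot0l xi : rdot 0 xi = 0.
Proof. by rewrite /rdot big1// => i _; rewrite mxE mul0r. Qed.

Definition gauss xi : R := expR (- (rdot xi xi / 2)).

Lemma norm_sqr_le_rdot xi : `|xi| ^+ 2 <= rdot xi xi.
Proof.
have r0 : 0 <= rdot xi xi by apply: sumr_ge0 => i _; rewrite -expr2 sqr_ge0.
rewrite -[leRHS]sqr_sqrtr// lerXn2r ?nnegrE ?sqrtr_ge0//.
apply: rV_norm_le; first exact: sqrtr_ge0.
move=> i; rewrite -sqrtr_sqr ler_sqrt// /rdot (bigD1 i)//= -expr2 lerDl.
by apply: sumr_ge0 => j _; rewrite -expr2 sqr_ge0.
Qed.

Lemma gauss_gt0 xi : 0 < gauss xi. Proof. exact: expR_gt0. Qed.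

Lemma gauss_decay m : exists C, forall xi, `|gauss xi| <= C * (1 + `|xi|) ^ (- m%:Z).
Proof.
case: m => [|m].
  exists 1 => xi; rewrite mul1r ger0_norm ?expR_ge0// expr0z /gauss.
  by rewrite -[leRHS]expR0 ler_expR lerNl oppr0 divr_ge0// (le_trans _ (norm_sqr_le_rdot xi)).
have m0 : 0 < m.+1%:R :> R by [].
(* With s = |xi|^2 / 2 (Euclidean), exp s is the power m + 1 of exp(s / (m + 1)) >= 1 + s / (m + 1),
   which is at least (1 + |xi|) / (4 (m + 1)). *)
exists ((4 * m.+1%:R) ^+ m.+1) => xi.
rewrite gtr0_norm ?gauss_gt0// /gauss expRN -exprnN -exprVn -exprMn.
set s := rdot xi xi / 2.
have s1 : (1 + `|xi|) / (4 * m.+1%:R) <= 1 + s / m.+1%:R.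
  have := norm_sqr_le_rdot xi; rewrite -/s => xis.
  have m1 : 1 <= m.+1%:R :> R by rewrite ler1n.
  rewrite ler_pdivrMr ?mulr_gt0//.
  have -> : (1 + s / m.+1%:R) * (4 * m.+1%:R) = 4 * m.+1%:R + 4 * s.
    by field; rewrite gt_eqF.
  have : `|xi| ^+ 2 <= 2 * s by rewrite /s mulrC divfK.
  have := sqr_ge0 (`|xi| - 1); have := normr_ge0 xi.
  by rewrite sqrrB; lra.
have -> : expR s = expR (s / m.+1%:R) ^+ m.+1.
  by rewrite -expRM_natl mulrC divfK ?gt_eqF.
have a0 : 0 <= 4 * m.+1%:R * (1 + `|xi|)^-1.
  by rewrite !mulr_ge0 ?invr_ge0// ltW.
rewrite -exprVn lerXn2r ?nnegrE ?invr_ge0 ?expR_ge0//.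
rewrite ler_pdivlMr// mulrC ler_pdivrMr ?expR_gt0// mulrC -ler_pdivrMr ?mulr_gt0//.
by rewrite (le_trans s1)// expR_ge1Dx.
Qed.

Lemma hpoly_rdot_sqr : hpoly 2 (fun xi : 'rV[R]_n => rdot xi xi).
Proof.
apply: hpoly_sum => i.
exact: (@hpolyM _ _ 1 1 _ _ (hpoly_coord i) (hpoly_coord i)).
Qed.

Lemma rdot_sqr_line (t : R) v xi : rdot (t *: v + xi) (t *: v + xi) =
  t * t * rdot v v + 2 * t * rdot v xi + rdot xi xi.
Proof.
rewrite rdot_linear !(rdotC (t *: v + xi)) !rdot_linear (rdotC xi v).
by ring.
Qed.

Lemma is_derive_gauss xi v : is_derive xi v gauss (- (rdot v xi * gauss xi)).
Proof.
apply: is_derive_cvg.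
have D : is_derive (0 : R) (1 : R) (fun t : R =>
   expR (- ((t * t * rdot v v + 2 * t * rdot v xi + rdot xi xi) / 2)))
   (- (rdot v xi * gauss xi)).
  apply: is_derive_eq; rewrite /gauss !mulr0 !mul0r !add0r !addr0.
  rewrite -![_ *: _]/(_ * _) !mulr0 !mul0r !add0r ?addr0 ?mulr1 ?mul1r.
  by field.
have /cvg_is_derive := D; apply: cvg_trans; apply: near_eq_cvg; apply: nearW => t.
rewrite addr0 -[_%:A]/(t * 1) mulr1 /gauss !mulr0 !mul0r !add0r.
by rewrite rdot_sqr_line.
Qed.

Lemma symb_gauss m : symb 1 (- m%:Z) gauss.
Proof.
split; first exact: gauss_decay.
split => [xi|v].
  apply: (@differentiable_comp _ _ _ _ (fun xi => - (rdot xi xi / 2)) (@expR R)).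
    rewrite (_ : (fun _ => _) = fun xi : 'rV[R]_n => - 2^-1 * rdot xi xi); last first.
      by apply/funext => y; rewrite mulNr mulrC.
    by have [_ []] := symbZ (- 2^-1) (symb_hpoly 1 hpoly_rdot_sqr).
  by apply/derivable1_diffP; exact: derivable_expR.
rewrite (_ : 'D_v gauss = fun xi => - (rdot v xi * gauss xi)); last first.
  by apply/funext => xi; apply: (@derive_val _ _ _ _ _ _ _ (is_derive_gauss xi v)).
rewrite (_ : - m%:Z = 1 + - m.+1%:Z); last first.
  by rewrite -addn1 PoszD opprD addrCA subrr addr0.
apply/symbN/symbM; first exact: symb_rdot.
split; first exact: gauss_decay.
apply: (@continuous_compose _ _ _ (fun xi => - (rdot xi xi / 2)) (@expR R)).
  apply: continuous_oppr; apply: continuous_mul; last exact: cst_continuous.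
  exact: symb_continuous (symb_hpoly 0 hpoly_rdot_sqr).
exact: continuous_expR.
Qed.

(** Since D_v [gauss] = -(v . xi) [gauss], differentiating under the integral and integrating by
    parts in frequency show that the transform obeys the differential equation of the Gaussian. *)
Lemma is_derive_osc_gauss z v :
  is_derive z v (osc gauss 0) (- (rdot z v * osc gauss 0 z)).
Proof.
have sg m : symb 0 (- m%:Z) gauss := symbS (symb_gauss m).
have := @is_derive_osc R n gauss 0 z v (sg _).
suff -> : osc (fun xi => rdot v xi * gauss xi) (0 + pi / 2) z =
    - (rdot z v * osc gauss 0 z) by [].
(* Phase pi is chosen because it becomes pi / 2 after integration by parts, while at pi the
   transform is minus the one at 0. *)
have := @rdot_osc R n gauss pi z v (symb_gauss _).
have -> : osc gauss pi z = - osc gauss 0 z.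
  rewrite -[RHS]mulN1r /osc -IntZ; last first.
    by apply: integrand_cos; exact: (symb_integrand (sg _)).
  by congr Int; apply/funext => xi; rewrite cosDpi addr0 mulN1r mulrN.
rewrite mulrN => ->; rewrite -[LHS]opprK; congr (- _).
have -> : 'D_v gauss = fun xi => -1 * (rdot v xi * gauss xi).
  apply/funext => xi; rewrite mulN1r.
  exact: (@derive_val _ _ _ _ _ _ _ (is_derive_gauss xi v)).
rewrite oscZ ?mulN1r ?add0r; last first.
  apply: (@symb_integrand _ _ 0).
  rewrite [X in symb _ X](_ : _ = 1 + - (2 * n).+1%:Z); last first.
    by rewrite -[(2 * n).+1]addn1 PoszD opprD addrCA subrr addr0.
  by apply: symbM => //; exact: symb_rdot.
by congr (- osc _ _ _); rewrite [X in X - _]splitr addrK.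
Qed.

(** The quotient of the transform by the Gaussian is constant along the ray through [z]; comparing s
    = 0 and s = 1 gives the factor. *)
Lemma osc_gauss z : osc gauss 0 z = Int gauss * gauss z.
Proof.
pose phi (s : R) := osc gauss 0 (s *: z + 0) * expR (s * s * rdot z z / 2).
have D s : is_derive s (1 : R) phi 0.
  have D1 := is_derive_line (is_derive_osc_gauss (s *: z + 0) z).
  have sE (a c : R) : a *: c = a * c by [].
  by apply: is_derive_eq; rewrite !sE !addr0 rdotZl; field.
have := is_derive_0_is_cst 1 0 D; rewrite /phi !scale1r scale0r !addr0 !mul0r expR0.
rewrite !mulr1 !mul1r => E.
have osc0 : osc gauss 0 0 = Int gauss.
  by congr Int; apply/funext => xi; rewrite rdot0l addr0 cos0 mulr1.
by rewrite -osc0 -E /gauss -mulrA -expRD subrr expR0 mulr1.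
Qed.

End gaussian.

Section low_pass_mass.
Context {R : realType} {n : nat}.
Variables (b : 'rV[R]_n -> R) (d N : nat).
Hypothesis b_ge0 : forall xi, 0 <= b xi.
Hypothesis hb : hpoly d b.
Hypothesis b_lower : exists2 c, 0 < c & forall xi, c * `|xi| ^+ d <= b xi.
Hypothesis dN : (2 * n < d * N)%N.

Let eta := osc (low_pass b N 1) 0.

Lemma symb_low_pass1 M : symb M (- (2 * n).+1%:Z) (low_pass b N 1).
Proof. by apply: symbZ_le dN _; exact: symb_low_pass. Qed.

(** Smoothness of the low-pass symbol gives decay of its transform: 2n frequency derivatives yield
    the weight (1 + |x|)^(-2n). *)
Lemma integrand_eta : integrand eta.
Proof.
split; first by apply: continuous_osc; exact: symb_low_pass1.
have [C C0 hC] := @osc_decay _ _ (2 * n) (low_pass b N 1) 0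
  (symbZ_le (leqnSn _) (symb_low_pass1 _)).
exists C => x; rewrite -exprnN ler_pdivlMr ?exprn_gt0 ?oneDnorm_gt0//.
by rewrite mulrC hC.
Qed.

(* Testing eta against dilated Gaussians avoids Fourier inversion. *)
Lemma Int_eta_gt0 : 0 < Int eta.
Proof.
pose h := low_pass b N 1.
have ih : integrand h by apply: symb_integrand; apply: symbZ_le (symb_low_pass1 0).
have ig : integrand (@gauss R n) := symb_integrand (symb_gauss _).
have cg : continuous (@gauss R n) by case: ig.
have bg : exists C, forall y : 'rV[R]_n, `|gauss y| <= C.
  by have [C CE] := @gauss_decay R n 0; exists C => y; rewrite -[C]mulr1; exact: CE.
have h_gt0 xi : 0 < h xi.
  by rewrite exprn_gt0// invr_gt0 ltr_pwDl// mul1r.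
have ihg : integrand (fun xi => h xi * gauss xi).
  under eq_fun do rewrite mulrC.
  exact: integrandMb.
pose l (j : nat) : R := 2 ^+ j.
have l0 j : 0 < l j by rewrite exprn_gt0.
have l_cvg : (l j)^-1 @[j --> \oo] --> 0.
  rewrite (_ : (fun j => _) = fun j => 2^-1 ^+ j); last first.
    by apply/funext => j; rewrite exprVn.
  by apply: cvg_expr; rewrite ger0_norm ?invr_ge0// invf_lt1// ltr1n.
have gauss0 : @gauss R n 0 = 1.
  by rewrite /gauss rdot0l mul0r oppr0 expR0.
have cvgI := @approximate_identity _ _ (@gauss R n) eta 0 l l0 l_cvg cg bg integrand_eta.
rewrite gauss0 mul1r in cvgI.
have g0 : 0 < Int (@gauss R n) by apply: Int_gt0 => // x; exact: gauss_gt0.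
have d0 : 0 < Int (@gauss R n) * Int (fun xi => h xi * gauss xi).
  by rewrite mulr_gt0// Int_gt0// => x; rewrite mulr_gt0// gauss_gt0.
(* The Gaussian averages of [eta] tend to its mass, so a positive lower bound uniform in j
   suffices. *)
apply: (lt_le_trans d0); rewrite -(cvg_lim _ cvgI)//; apply: limr_ge.
  by apply/cvg_ex; exists (Int eta).
apply: nearW => j; set s := (l j)^-1.
have s0 : 0 < s by rewrite invr_gt0.
have lj : l j = s^-1 by rewrite invrK.
have ihs : integrand (fun xi => h (s *: xi)).
  have := integrand_affine 0 s0 ih.
  by under eq_fun do rewrite add0r.
have ios : integrand (fun y => osc (fun xi => h (s *: xi)) 0 y * gauss y).
  have -> : (fun y => osc (fun xi => h (s *: xi)) 0 y * gauss y) =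
      fun y => l j ^+ n * (gauss y * eta (l j *: (0 + y))).
    apply/funext => y; rewrite add0r lj /eta osc_scale// -/h.
    by rewrite exprVn; field; rewrite expf_neq0// gt_eqF.
  apply: integrandZ; apply: integrandMb => //.
  rewrite (_ : (fun y => eta _) = fun y => eta (0 + l j *: y)).
    exact: integrand_affine integrand_eta.
  by apply/funext => y; rewrite !add0r.
rewrite [leRHS](_ : _ = Int (fun xi => h (s *: xi) * osc gauss 0 xi)); last first.
  rewrite -Int_osc_swap// -IntZ.
    congr Int; apply/funext => y; rewrite subr0 lj /eta osc_scale// -/h.
    by rewrite exprVn; field; rewrite expf_neq0// gt_eqF.
  apply: integrandMb => //.
  rewrite (_ : (fun y => eta _) = fun y => eta (0 + l j *: y)).
    exact: integrand_affine integrand_eta.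
  by apply/funext => y; rewrite subr0 add0r.
have ihsg : integrand (fun xi => h (s *: xi) * gauss xi).
  by under eq_fun do rewrite mulrC; exact: integrandMb.
rewrite (_ : (fun xi => h (s *: xi) * osc gauss 0 xi) =
    fun xi => Int (@gauss R n) * (h (s *: xi) * gauss xi)); last first.
  by apply/funext => xi; rewrite osc_gauss mulrCA.
(* As s <= 1, homogeneity gives b(s xi) <= b(xi), hence h(s xi) >= h(xi): the bound does not depend
   on j. *)
rewrite IntZ// ler_wpM2l ?(ltW g0)//; apply: le_Int => // xi.
rewrite ler_wpM2r ?(ltW (gauss_gt0 _))//.
have pos y : 0 < 1 + 1 * b y by rewrite ltr_pwDl// mul1r.
rewrite /h /low_pass lerXn2r ?nnegrE ?invr_ge0 ?(ltW (pos _))//.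
rewrite lef_pV2 ?posrE// lerD2l !mul1r (hpoly_homogeneous _ _ hb).
rewrite ler_piMl// exprn_ile1 ?(ltW s0)// invf_le1// /l.
by rewrite exprn_ege1// ler1n.
Qed.

End low_pass_mass.

(** * The estimate for one component, by telescoping over dyadic scales *)

Section scalar_estimate.
Context {R : realType} {n : nat}.
Variables (Idx : finType) (la : Idx -> seq 'I_n) (k p q : nat).
Variable Am : Idx -> 'M[R]_(p, q).
Hypothesis size_la : forall a, size (la a) = k.
Hypothesis n_gt0 : (0 < n)%N.
Hypothesis n_le_k : (n <= k)%N.
Hypothesis p_gt0 : (0 < p)%N.
Local Notation P := (system_symbol la Am).
Hypothesis P_free : forall xi, xi != 0 -> row_free (P xi).
Hypothesis P_cancel : forall e : 'rV[R]_q,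
  (forall xi, xi != 0 -> (e <= P xi)%MS) -> e = 0.
Implicit Types (x xi : 'rV[R]_n).

Let d := bdeg p k.
Let N := (2 * n + k.+1 + d)%N.
Let b := bsym P.
Let h := low_pass b N 1.
Let eta := osc h 0.

Let k_gt0 : (0 < k)%N. Proof. exact: leq_trans n_le_k. Qed.
Let d_gt0 : (0 < d)%N. Proof. exact: bdeg_gt0. Qed.
Let hb : hpoly d b. Proof. exact/hpoly_bsym/hpoly_system_symbol. Qed.
Let b_ge0 xi : 0 <= b xi. Proof. exact: bsym_ge0. Qed.
Let b_lower : exists2 c, 0 < c & forall xi, c * `|xi| ^+ d <= b xi.
Proof.
by apply: bsym_lower_bound => // i j; exact: hpoly_system_symbol.
Qed.
Let N_le : (N <= d * N)%N. Proof. by rewrite leq_pmull. Qed.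
Let dN : (2 * n < d * N)%N.
Proof. by apply: leq_trans N_le; rewrite /N addnS addSn ltnS -addnA leq_addr. Qed.

Let iota_eta : integrand eta.
Proof. exact: integrand_eta b_ge0 hb b_lower dN. Qed.

Let sym_h M : symb M (- (2 * n).+1%:Z) h.
Proof. exact: (symb_low_pass1 b_ge0 hb b_lower dN). Qed.

Let Phi (w : 'rV[R]_n -> R) x (l : R) :=
  l ^+ n * Int (fun y => w y * eta (l *: (y - x))).

(** Multiplied by the symbol, this vector in [e] becomes b times mono [beta] times [band] in slot
    [v] and 0 in the other slots. *)
Let g beta v e xi : R :=
  left_inv P xi e v * (mono beta xi * band b d N xi).

Let symb_g beta v e M : size beta = (k - n)%N ->
  symb M (- (2 * n + k.+1 + d)%:Z) (g beta v e).
Proof.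
move=> sbeta.
have s1 := symb_hpoly M (hpoly_left_inv (k := k) (P := P) (hpoly_system_symbol _ size_la) e v).
have s2 := @symb_mono R n M beta.
have s3 := @symb_band R n b d N b_ge0 hb b_lower M.
apply: symb_le (symbM s1 (symbM s2 s3)).
rewrite sbeta -/N; set D := (_ + (k + _))%N.
(* The inverse matrix has degree d - k, so with the monomial of degree k - n the total is below d;
   one of the N + 1 resolvents absorbs it. *)
have dE : d = (D + k)%N.
  by rewrite /d /bdeg /D -{2}(prednK p_gt0) mulSn; lia.
have : (D + (k - n) + N <= d * N.+1)%N.
  rewrite mulnS (leq_trans (leq_add (leqnn _) N_le))// leq_add2r dE leq_add2l.
  exact: leq_subr.
move: (d * N.+1)%N => X DX.
lia.
Qed.

(** Both sides are brought to integrals of [u v] without derivatives. On the left l^n (-l)^(k - n)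
    appears, on the right (-1)^n (-l)^k: the powers of [l] match. The phase -n pi / 2 makes up for k
    derivatives against k - n. *)
Let Phi_diff u beta v x (l : R) : 0 < l -> (forall v, test_function (u v)) ->
  size beta = (k - n)%N ->
  Phi (partials beta (u v)) x l - Phi (partials beta (u v)) x (l / 2) =
  (-1) ^+ n * \sum_e Int (fun y => system la Am u e y *
    osc (g beta v e) (- (n%:R * (pi / 2))) (l *: (y - x))).
Proof.
move=> l0 tu sbeta.
set w := partials beta (u v).
have [cw bw] : continuous w /\ bounded_support w.
  split; first exact: test_function_continuous.
  by have [] := test_function_partials beta (tu v).
have ih : integrand h by apply: symb_integrand; apply: symbZ_le (sym_h 0).
have ih2 : integrand (fun xi => h (2 *: xi)).
  have := integrand_affine 0 (ltr0Sn R 1) ih.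
  by under eq_fun do rewrite add0r.
have iwe : integrand (fun y => w y * eta (l *: (y - x))).
  by apply: integrand_test => //; exact: continuous_osc_affine (sym_h 0).
have iwe2 : integrand (fun y => w y * eta ((l / 2) *: (y - x))).
  by apply: integrand_test => //; exact: continuous_osc_affine (sym_h 0).
have bandE xi : h xi - h (2 *: xi) = b xi * band b d N xi by exact: low_pass_band.
have sbb : symb 0 (- (N)%:Z) (fun xi => b xi * band b d N xi).
  apply: symb_le (symbM (symb_hpoly 0 hb) (@symb_band R n b d N b_ge0 hb b_lower 0)).
  rewrite mulnS PoszD opprD addrA subrr add0r lerN2 lez_nat; exact: N_le.
have sbb1 : symb 0 (- (2 * n).+1%:Z) (fun xi => b xi * band b d N xi).
  by apply: symbZ_le sbb; rewrite /N addnS addSn ltnS -addnA leq_addr.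
have iwb : integrand (fun y => w y * osc (fun xi => b xi * band b d N xi) 0 (l *: (y - x))).
  by apply: integrand_test => //; exact: continuous_osc_affine.
transitivity (l ^+ n * Int (fun y => w y *
    osc (fun xi => b xi * band b d N xi) 0 (l *: (y - x)))).
  rewrite /Phi -!IntZ// -IntB; try exact: integrandZ.
  congr Int; apply/funext => y; set z := l *: (y - x).
  have -> : (l / 2) *: (y - x) = 2^-1 *: z by rewrite scalerA mulrC.
  have -> : osc (fun xi => b xi * band b d N xi) 0 z =
      eta z - osc (fun xi => h (2 *: xi)) 0 z.
    rewrite -[X in _ = _ + X]mulN1r -oscZ// -oscD//; last exact: integrandZ.
    by congr osc; apply/funext => xi; rewrite -bandE mulN1r.
  rewrite /eta (osc_scale 0 z (ltr0Sn R 1) ih) exprMn exprVn -/eta.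
  by field; rewrite expf_neq0.
have lk : l ^+ n * (- l) ^+ (k - n) = (-1) ^+ n * (- l) ^+ k.
  rewrite -{2}(subnKC n_le_k) exprD mulrA; congr (_ * _).
  by rewrite -exprMn mulN1r opprK.
rewrite (system_duality Am size_la)//; last first.
  by move=> e; apply: symbZ_le (symb_g v e 0 sbeta); exact: leq_addr.
rewrite mulrA -lk -mulrA; congr (_ * _).
rewrite (bigD1 v)//= big1 ?addr0 => [|i iv]; last first.
  rewrite (_ : (fun y => _) = fun=> 0) ?Int0//; apply/funext => y.
  rewrite (_ : (fun xi => _) = fun=> 0); last first.
    apply/funext => xi; rewrite /g; under eq_bigr do rewrite mulrA.
    have /matrixP/(_ i v) := mul_left_inv P xi; rewrite !mxE (negbTE iv) mulr0n => E.
    by rewrite -mulr_suml E mul0r.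
  rewrite /osc (_ : (fun xi => _) = fun=> 0) ?Int0 ?mulr0//.
  by apply/funext => xi; rewrite mul0r.
rewrite /w (Int_partials_osc _ _ _ (tu v)); last first.
  apply: symbZ_le sbb; rewrite sbeta /N; lia.
rewrite sbeta; congr (_ * Int _); apply/funext => y; congr (_ * osc _ _ _).
  apply/funext => xi; rewrite /g; under [in RHS]eq_bigr do rewrite mulrA.
  have /matrixP/(_ v v) := mul_left_inv P xi; rewrite !mxE eqxx mulr1n => E.
  by rewrite -mulr_suml E mulrCA.
by rewrite add0r natrB//; ring.
Qed.

(** The integral is at most Int |h| times Int |w| at every scale, and the prefactor l^n tends to
    0. *)
Let Phi_lim0 (w : 'rV[R]_n -> R) x (l : R) : 0 < l -> continuous w ->
  bounded_support w -> Phi w x (l / 2 ^+ M) @[M --> \oo] --> 0.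
Proof.
move=> l0 cw bw.
have iw := integrand_bounded_support cw bw.
have ih : integrand h by apply: symb_integrand; apply: symbZ_le (sym_h 0).
set K := Int (fun xi => `|h xi|) * Int (fun y => `|w y|).
have hi : l ^+ n * K * (2^-1 ^+ n) ^+ M @[M --> \oo] --> 0.
  rewrite -[X in _ --> X](mulr0 (l ^+ n * K)); apply: cvgMl_tmp.
  apply: cvg_expr; rewrite ger0_norm ?exprn_ge0 ?invr_ge0//.
  by rewrite exprn_ilt1 ?invr_ge0// -?lt0n// invf_lt1// ltr1n.
apply: norm_cvg0; apply: (@squeeze_cvgr _ _ _ _ (cst 0) _ _ _ _ _ hi) => //.
  apply/nearW => M; rewrite /= normr_ge0/= /Phi normrM.
  have lM : 0 < l / 2 ^+ M by rewrite divr_gt0// exprn_gt0.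
  rewrite ger0_norm ?exprn_ge0 ?(ltW lM)//.
  have -> : (l / 2 ^+ M) ^+ n = l ^+ n * (2^-1 ^+ n) ^+ M.
    by rewrite exprMn -exprVn -!exprM mulnC.
  rewrite -!mulrA ler_wpM2l ?exprn_ge0 ?(ltW l0)// mulrC mulrA.
  rewrite ler_wpM2r ?exprn_ge0 ?invr_ge0//.
  rewrite -IntZ; last exact: integrand_norm.
  apply: Int_bound.
  - by apply: integrand_test => //; exact: continuous_osc_affine (sym_h 0).
  - by apply: integrandZ; exact: integrand_norm.
  - by move=> y; rewrite normrM mulrC ler_wpM2r// norm_osc_le.
exact: cvg_cst.
Qed.

Let Phi_bound beta v : size beta = (k - n)%N ->
  exists C, 0 <= C /\ forall u F x (l : R), 0 < l -> (forall v, test_function (u v)) ->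
    integrand F -> (forall y, 0 <= F y) -> (forall e y, `|system la Am u e y| <= F y) ->
    `|Phi (partials beta (u v)) x l| <= C * Int F.
Proof.
move=> sbeta.
have bT := kernel_bounded_sum (index_enum 'I_q) (fun e =>
  kernel_bounded_canceling size_la (- (n%:R * (pi / 2))) e p_gt0 P_free P_cancel
    (symb_g v e (d + 2) sbeta)).
have [C TC] := bT.
exists (2 * `|C|); split; first by rewrite mulr_ge0.
move=> u F x l l0 tu iF F0 fF; set w := partials beta (u v).
(* Increasing and bounded by 1: its dyadic increments dominate [omega] up to the factor 2, so the
   sum over scales is at most 2 |C| Int F. *)
pose B (r : R) := r / (1 + r).
pose H (l : R) := Int (fun y => F y * B (l * `|y - x|)).
have iH (s : R) : 0 < s -> integrand (fun y => F y * B (s * `|y - x|)).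
  move=> s0.
  have sy y : 0 <= s * `|y - x| by rewrite mulr_ge0// ltW.
  have cn := @continuous_scaled_dist R n s x.
  under eq_fun do rewrite mulrC.
  apply: integrandMb => //.
    apply: continuous_mul => //; apply: continuous_inv => [|y].
      by apply: continuous_add => //; exact: cst_continuous.
    by rewrite gt_eqF// ltr_pwDl.
  exists 1 => y; rewrite ger0_norm ?divr_ge0 ?addr_ge0//.
  by rewrite ler_pdivrMr ?ltr_pwDl// mul1r lerDr.
have step (s : R) : 0 < s ->
    `|Phi w x s - Phi w x (s / 2)| <= 2 * `|C| * (H s - H (s / 2)).
  move=> s0; have s20 : 0 < s / 2 by rewrite divr_gt0.
  rewrite Phi_diff// normrM normrX normrN1 expr1n mul1r.
  apply: (le_trans (TC u F x s s0 tu iF fF)).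
  rewrite /H -IntB; [|exact: iH|exact: iH].
  rewrite (mulrC 2) -mulrA.
  have iD : integrand (fun y => F y * B (s * `|y - x|) - F y * B (s / 2 * `|y - x|)).
    by apply: integrandB; exact: iH.
  have iO : integrand (fun y => F y * omega (s * `|y - x|)) by exact: integrand_omega.
  have O0 : 0 <= Int (fun y => F y * omega (s * `|y - x|)).
    by apply: Int_ge0 => y; rewrite mulr_ge0// omega_ge0// mulr_ge0// ltW.
  apply: (@le_trans _ _ (`|C| * Int (fun y => F y * omega (s * `|y - x|)))).
    by rewrite ler_wpM2r// ler_norm.
  rewrite ler_wpM2l// -IntZ//; apply: le_Int => //; first exact: integrandZ.
  move=> y; rewrite -mulrBr [leRHS]mulrCA ler_wpM2l//.
  have : 0 <= s * `|y - x| by rewrite mulr_ge0// ltW.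
  rewrite (mulrAC s); move: (s * _) => r r0; rewrite /B /omega.
  have r1 : 0 < 1 + r by rewrite ltr_pwDl.
  have r2 : 0 < 1 + r / 2 by rewrite ltr_pwDl// divr_ge0.
  rewrite -subr_ge0.
  have -> : 2 * (r / (1 + r) - r / 2 / (1 + r / 2)) - r / (1 + r) ^+ 2 =
      r * (r / 2) / ((1 + r) ^+ 2 * (1 + r / 2)).
    by field; rewrite (gt_eqF r1) gt_eqF// ltr_pwDl.
  by rewrite !mulr_ge0// ?invr_ge0 ?mulr_ge0 ?exprn_ge0// ltW.
have tele M : `|Phi w x l - Phi w x (l / 2 ^+ M)| <=
    2 * `|C| * (H l - H (l / 2 ^+ M)).
  elim: M => [|M IH]; first by rewrite expr0 divr1 !subrr normr0 mulr0.
  have := step (l / 2 ^+ M); rewrite divr_gt0 ?exprn_gt0// => /(_ isT).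
  rewrite -mulrA -invfM -exprSr => st.
  rewrite -(subrKA (Phi w x (l / 2 ^+ M)) (Phi w x l)) (le_trans (ler_normD _ _))//.
  by rewrite -(subrKA (H (l / 2 ^+ M)) (H l)) mulrDr; apply: lerD.
have HF : H l <= Int F.
  apply: le_Int => //; first exact: iH.
  move=> y; rewrite ler_piMr//.
  have r0 : 0 <= l * `|y - x| by rewrite mulr_ge0// ltW.
  by rewrite ler_pdivrMr ?ltr_pwDl// mul1r lerDr.
have H0 (s : R) : 0 < s -> 0 <= H s.
  move=> s0; apply: Int_ge0 => y; rewrite mulr_ge0//.
  have r0 : 0 <= s * `|y - x| by rewrite mulr_ge0// ltW.
  by rewrite divr_ge0// addr_ge0.
have [cw bw] : continuous w /\ bounded_support w.
  split; first exact: test_function_continuous.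
  by have [] := test_function_partials beta (tu v).
(* The coarse term left over after M halvings is made smaller than [e]. *)
apply/ler_addgt0Pr => e e0.
have /cvgr0_norm_le/(_ _ e0)[M _ /(_ M (leqnn M)) PM] := Phi_lim0 x l0 cw bw.
rewrite -(subrK (Phi w x (l / 2 ^+ M)) (Phi w x l)) (le_trans (ler_normD _ _))//.
rewrite lerD// (le_trans (tele M))// ler_wpM2l ?mulr_ge0//.
rewrite (le_trans _ HF)// gerDl oppr_le0 H0// divr_gt0// exprn_gt0//.
Qed.

(** [Phi_bound] is uniform in the scale; letting l = 2^j tend to infinity turns the left side into
    |w(x)| times the positive mass of [eta]. *)
Lemma scalar_estimate beta v : size beta = (k - n)%N ->
  exists C, forall u F x, (forall v, test_function (u v)) ->
    integrand F -> (forall y, 0 <= F y) -> (forall e y, `|system la Am u e y| <= F y) ->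
    `|partials beta (u v) x| <= C * Int F.
Proof.
move=> sbeta; have [C [C0 PC]] := Phi_bound v sbeta.
have c0 : 0 < Int eta by exact: Int_eta_gt0 b_ge0 hb b_lower dN.
exists (C / Int eta) => u F x tu iF F0 fF; set w := partials beta (u v).
have [cw bw] : continuous w /\ bounded_support w.
  split; first exact: test_function_continuous.
  by have [] := test_function_partials beta (tu v).
pose l (j : nat) : R := 2 ^+ j.
have l0 j : 0 < l j by rewrite exprn_gt0.
have l_cvg : (l j)^-1 @[j --> \oo] --> 0.
  rewrite (_ : (fun j => _) = fun j => 2^-1 ^+ j); last first.
    by apply/funext => j; rewrite exprVn.
  by apply: cvg_expr; rewrite ger0_norm ?invr_ge0// invf_lt1// ltr1n.
have bdw : exists D, forall y, `|w y| <= D.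
  have [D wD] := bounded_support_bounded cw bw 0.
  by exists D => y; rewrite -[D]mulr1; exact: wD.
have cvgI := cvg_norm (@approximate_identity _ _ w eta x l l0 l_cvg cw bdw iota_eta).
rewrite mulrAC ler_pdivlMr// -[X in _ * X]gtr0_norm// -normrM.
rewrite -(cvg_lim _ (cvgI _))//; apply: limr_le.
  by apply/cvg_ex; exists `|w x * Int eta|; exact: cvgI.
by apply: nearW => j; exact: PC.
Qed.

End scalar_estimate.

(** * Operators between normed spaces *)

Section coordinates.
Context {R : realType} {W : normedVectType R}.
Local Notation d := (\dim {:W}).
Local Notation bW := (vbasis {:W}).
Implicit Types (x y : W).

Definition lincomb (c : 'rV[R]_d) : W := \sum_i c 0 i *: bW`_i.

Lemma coord_lincomb c i : coord bW i (lincomb c) = c 0 i.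
Proof. by rewrite coord_sum_free// (basis_free (vbasisP _)). Qed.

Lemma coord_vbasisT x : x = \sum_i coord bW i x *: bW`_i.
Proof. by rewrite -coord_vbasis// memvf. Qed.

(** Equivalence of norms: |lincomb c| is positive on the unit sphere by freeness of the basis, and
    the inverse of its minimum is the constant. *)
Lemma coord_bound : exists2 K : R, 0 <= K & forall i x, `|coord bW i x| <= K * `|x|.
Proof.
have [d0|d0] := posnP d.
  exists 0 => // i; exfalso.
  have : (0 < d)%N by exact: leq_ltn_trans (ltn_ord i).
  by rewrite d0.
have clin : continuous (fun c : 'rV[R]_d => `|lincomb c|).
  apply: continuous_abs.
  apply: (@continuous_sum _ _ W _ _ _ (fun (i : 'I_d) (c : 'rV[R]_d) => c 0 i *: bW`_i)) => i.
  by apply: continuous_scalel; exact: coord_continuous.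
have [c c1 cmin] := min_on_sphere d0 clin.
have c0 : 0 < `|lincomb c|.
  rewrite normr_gt0; apply/negP => /eqP lc.
  have : `|c| = 0.
    apply/eqP; rewrite normr_eq0; apply/eqP/rowP => i.
    by rewrite -coord_lincomb lc linear0 mxE.
  by move/eqP; rewrite c1 oner_eq0.
exists `|lincomb c|^-1 => [|i x]; first by rewrite invr_ge0.
pose r : 'rV[R]_d := \row_i coord bW i x.
have xr : x = lincomb r by rewrite {1}(coord_vbasisT x); apply: eq_bigr => j _; rewrite mxE.
rewrite mulrC ler_pdivlMr//.
have [r0|r0] := eqVneq r 0.
  by rewrite xr coord_lincomb r0 mxE normr0 mul0r.
have nr0 : 0 < `|r| by rewrite normr_gt0.
have := cmin (`|r|^-1 *: r); rewrite normrZ ger0_norm ?invr_ge0// mulVf ?gt_eqF// => /(_ erefl).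
have -> : lincomb (`|r|^-1 *: r) = `|r|^-1 *: x.
  by rewrite xr /lincomb scaler_sumr; apply: eq_bigr => j _; rewrite mxE scalerA.
rewrite normrZ ger0_norm ?invr_ge0// mulrC ler_pdivlMr// => /(le_trans _); apply.
rewrite mulrC ler_wpM2l//.
by rewrite [X in coord _ _ X]xr coord_lincomb ler_coord_norm.
Qed.

Lemma continuous_coord i : continuous (coord bW i : W -> R).
Proof.
have [K K0 coordK] := coord_bound.
apply: (lipschitz_continuous K0) => x y.
by rewrite -linearB coordK.
Qed.

Lemma is_derive_coord n (i : 'I_d) (f : 'rV[R]_n -> W) (z v : 'rV[R]_n) l : is_derive z v f l ->
  is_derive z v (coord bW i \o f) (coord bW i l).
Proof.
move=> /cvg_is_derive fl; apply: is_derive_cvg.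
apply: cvg_trans (continuous_cvg _ (@continuous_coord i l) fl).
by apply: near_eq_cvg; apply: nearW => h /=; rewrite linearZ linearB.
Qed.

Lemma partials_coord n (i : 'I_d) (u : 'rV[R]_n -> W) s : smooth u ->
  partials s (coord bW i \o u) = coord bW i \o partials s u.
Proof.
move=> su; elim: s => [//|j s IH]; apply/funext => y.
rewrite -[LHS]/('D_(basis_vector j) (partials s (coord bW i \o u)) y) IH.
have D : is_derive y (basis_vector j) (partials s u) (partials (j :: s) u y).
  by apply: DeriveDef => //; have [_] := su s; exact.
exact: (@derive_val _ _ _ _ _ _ _ (is_derive_coord i D)).
Qed.

Lemma test_function_coord n (i : 'I_d) (u : 'rV[R]_n -> W) :
  smooth u -> compactly_supported u -> test_function (coord bW i \o u).
Proof.
move=> su cu; split=> [s|].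
  rewrite partials_coord//; have [cs ds] := su s; split=> [|y j].
    exact: (continuous_compose cs (@continuous_coord i)).
  by have /derivableP/(is_derive_coord i)[] := ds y j.
have [M [_ uM]] := compact_bounded cu.
exists (M + 1) => y yM; apply/eqP; apply: contraTT yM => uy; rewrite -leNgt.
apply: uM; first by rewrite ltrDl.
apply: subset_closure => /=; apply: contraNN uy => /eqP /= ->.
by rewrite linear0.
Qed.

End coordinates.

Section operator_in_coordinates.
Context {R : realType} {n k : nat} {V E : normedVectType R}.
Variable A : homogeneous_operator n k V E.
Local Notation bV := (vbasis {:V}).
Local Notation bE := (vbasis {:E}).

(** The very list along which [multi_partial] differentiates, so the two agree by conversion. *)
Definition derivation_seq (a : multi_index n k) : seq 'I_n :=
  flatten [seq nseq (val a i) i | i <- enum 'I_n].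

Definition operator_mx (a : multi_index n k) : 'M[R]_(\dim {:V}, \dim {:E}) :=
  \matrix_(v, e) coord bE e (A a bV`_v).

Lemma size_derivation_seq a : size (derivation_seq a) = k.
Proof.
rewrite size_flatten sumnE /shape -map_comp big_map.
rewrite (eq_bigr (fun i => val a i : nat)) => [|i _]; last by rewrite /= size_nseq.
by rewrite big_enum; apply/eqP; exact: (valP a).
Qed.

Lemma mono_derivation_seq a xi :
  mono (derivation_seq a) xi = \prod_i xi 0 i ^+ val a i :> R.
Proof.
rewrite /mono big_flatten big_map big_enum; apply: eq_bigr => i _.
by rewrite big_nseq iter_mulr_1.
Qed.

Lemma coord_operator a e (x : V) :
  coord bE e (A a x) = \sum_v operator_mx a v e * coord bV v x.
Proof.
rewrite {1}(coord_vbasisT x) !linear_sum; apply: eq_bigr => v _.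
by rewrite !linearZ mxE mulrC.
Qed.

Lemma coord_apply_operator u e y : smooth u ->
  coord bE e (apply_operator A u y) =
  system derivation_seq operator_mx (fun v => coord bV v \o u) e y.
Proof.
move=> su; rewrite linear_sum; apply: eq_bigr => a _.
by rewrite [LHS]coord_operator; apply: eq_bigr => v _; rewrite partials_coord.
Qed.

Lemma coord_symbol xi r e :
  coord bE e (symbol A xi (lincomb r)) =
  (r *m system_symbol derivation_seq operator_mx xi) 0 e.
Proof.
rewrite /symbol sum_lfunE linear_sum mxE.
under [RHS]eq_bigr do rewrite mxE mulr_sumr.
rewrite exchange_big; apply: eq_bigr => a _.
rewrite scale_lfunE linearZ -mono_derivation_seq.
rewrite -[LHS]/(_ * coord bE e (A a _)) coord_operator mulr_sumr.
by apply: eq_bigr => v _; rewrite coord_lincomb mulrC mulrAC mulrC.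
Qed.

Lemma row_free_system_symbol xi : injective (symbol A xi) ->
  row_free (system_symbol derivation_seq operator_mx xi).
Proof.
move=> inj; apply: inj_row_free => r r0.
have lr : lincomb r = 0 :> V.
  apply: inj; rewrite linear0 [LHS]coord_vbasisT big1// => e _.
  by rewrite coord_symbol r0 mxE scale0r.
by apply/rowP => i; rewrite -coord_lincomb lr linear0 mxE.
Qed.

Lemma canceling_system_symbol (r : 'rV[R]_(\dim {:E})) : canceling A ->
  (forall xi, xi != 0 -> (r <= system_symbol derivation_seq operator_mx xi)%MS) ->
  r = 0.
Proof.
move=> canA rA; have lr : lincomb r = 0 :> E.
  suff : [set 0 : E] (lincomb r) by [].
  rewrite -canA => xi /= xi0; have /submxP[c rc] := rA xi xi0.
  exists (lincomb c) => //.
  rewrite [LHS]coord_vbasisT; apply: eq_bigr => e _.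
  by rewrite coord_symbol -rc.
by apply/rowP => i; rewrite -coord_lincomb lr linear0 mxE.
Qed.

(** Expanding A(D)u in the basis of [E] reduces continuity and decay to its scalar components. *)
Lemma integrand_apply_operator u : smooth u -> compactly_supported u ->
  integrand (fun y => `|apply_operator A u y|).
Proof.
move=> su cu.
have AE : apply_operator A u = fun y => \sum_e
    system derivation_seq operator_mx (fun v => coord bV v \o u) e y *: bE`_e.
  apply/funext => y; rewrite [LHS]coord_vbasisT.
  by apply: eq_bigr => e _; rewrite coord_apply_operator.
have tu v : test_function (coord bV v \o u) by exact: test_function_coord.
pose S e y := system derivation_seq operator_mx (fun v => coord bV v \o u) e y.
have iS : integrand (fun y => \sum_(e < \dim {:E}) `|bE`_e| * `|S e y|).
  apply: (@integrand_sum _ _ _ _ _ (fun (e : 'I_(\dim {:E})) y => `|bE`_e| * `|S e y|)) => e.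
  apply: integrandZ; apply: integrand_norm.
  by apply: integrand_bounded_support; [exact: continuous_system|exact: bounded_support_system].
have cA : continuous (fun y => `|apply_operator A u y|).
  apply: continuous_abs; rewrite AE.
  apply: (@continuous_sum _ _ E _ _ _ (fun (e : 'I_(\dim {:E})) y => S e y *: bE`_e)) => e.
  by apply: continuous_scalel; exact: continuous_system.
apply: (le_integrand cA iS) => y.
rewrite normr_id AE ger0_norm ?sumr_ge0//.
rewrite (le_trans (ler_norm_sum _ _ _))// ler_sum// => e _.
by rewrite normrZ mulrC.
Qed.

End operator_in_coordinates.

Lemma sqrt_sum_sqr_le {R : realType} I (s : seq I) (f : I -> R) :
  (forall i, 0 <= f i) -> Num.sqrt (\sum_(i <- s) f i ^+ 2) <= \sum_(i <- s) f i.
Proof.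
move=> f0; rewrite -[leRHS]ger0_norm ?sumr_ge0// -sqrtr_sqr ler_wsqrtr//.
elim: s => [|a s IH]; first by rewrite !big_nil expr0n.
rewrite !big_cons sqrrD -addrA lerD2l (le_trans IH)// lerDr.
by rewrite mulrn_wge0// mulr_ge0// sumr_ge0.
Qed.

Theorem theorem3 (R : realType) (n k : nat) (n_gt0 : (0 < n)%N)
    (n_le_k : (n <= k)%N) (V E : normedVectType R)
    (dotV : {dot V for (@idfun R)}) (dotE : {dot E for (@idfun R)})
    (normV : norm_of_dot dotV) (normE : norm_of_dot dotE)
    (A : homogeneous_operator n k V E) (A_elliptic : elliptic A)
    (A_canceling : canceling A) :
  exists C : R, 0 < C /\
    forall u : 'rV[R]_n -> V, smooth u -> compactly_supported u ->
      (ereal_sup [set (multilinear_norm (total_derivative (j := (k - n)%N) u x))%:E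
                 | x in [set: 'rV[R]_n]]
       <= C%:E * integral_Rn (fun x => `|apply_operator A u x|%:E))%E.
Proof.
pose bV := vbasis {:V}.
have [K K0 coordK] := @coord_bound R E.
have estimate (i : (k - n).-tuple 'I_n) (v : 'I_(\dim {:V})) :
    exists C, forall u x, smooth u -> compactly_supported u ->
      `|coord bV v (partials i u x)| <= C * Int (fun y => `|apply_operator A u y|).
  have [C PC] := @scalar_estimate R n _ _ k _ _ _ (@size_derivation_seq n k)
    n_gt0 n_le_k (leq_ltn_trans (leq0n _) (ltn_ord v))
    (fun xi xi0 => row_free_system_symbol (A_elliptic xi xi0))
    (fun r => canceling_system_symbol A_canceling) i v (size_tuple i).
  (* K |A(D)u| majorizes every component of the system, so it is the function [F] of the scalar
     estimate. *)
  exists (C * K) => u x su cu; have iA := integrand_apply_operator A su cu.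
  rewrite -mulrA -IntZ//.
  have := PC (fun v => coord bV v \o u) (fun y => K * `|apply_operator A u y|) x.
  rewrite partials_coord//; apply.
  - by move=> ?; exact: test_function_coord.
  - exact: integrandZ.
  - by move=> y; exact: mulr_ge0.
  - by move=> e y; rewrite -coord_apply_operator.
pose C i v := sval (cid (estimate i v)).
have PC i v := svalP (cid (estimate i v)).
(* The Hilbert-Schmidt norm is bounded by the sum over index tuples, and each partial derivative by
   the sum over its coordinates. [D] may be 0, hence [D + 1] below. *)
pose D := \sum_(i : (k - n).-tuple 'I_n) \sum_v `|C i v| * `|bV`_v|.
have D0 : 0 <= D.
  by apply: sumr_ge0 => i _; apply: sumr_ge0 => v _; exact: mulr_ge0.
exists (D + 1); split; first by rewrite ltr_wpDl.
move=> u su cu; have iA := integrand_apply_operator A su cu.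
rewrite integral_Rn_Int// -EFinM; apply: ge_ereal_sup => _ [x _ <-].
set I := Int _; have I0 : 0 <= I by apply: Int_ge0.
rewrite lee_fin; apply: (@le_trans _ _ (D * I)); last first.
  by rewrite ler_wpM2r// lerDl.
apply: le_trans (sqrt_sum_sqr_le _ (fun i => normr_ge0 _)) _.
rewrite mulr_suml; apply: ler_sum => i _.
rewrite -[X in `|X|]/(partials i u x) (coord_vbasisT (partials i u x)).
rewrite (le_trans (ler_norm_sum _ _ _))// mulr_suml; apply: ler_sum => v _.
rewrite normrZ mulrAC ler_wpM2r// (le_trans (PC i v u x su cu))//.
by rewrite ler_wpM2r// ler_norm.
Qed.
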